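(* Let $X=[a_1,b_1]\times\cdots\times[a_n,b_n]$ for finite numbers $\{a_i\},\{b_i\}$, let $F(\mathbf x)=\mathbb E_\xi[f(\mathbf x;\xi)]$ be convex, $F^*=\min_{\mathbf x\in X}F(\mathbf x)$, and $D_\infty=\max_{\mathbf x,\mathbf y\in X}\|\mathbf x-\mathbf y\|_\infty$. Let $\{\mathbf x^{(k)}\}$ be generated by the algorithm APAM with delayed gradients (see context), where for any $i\in\{1,\dots,n\}$ we let $x_i^{(k+1)}=x_i^{(k)}$ if $\widehat v_i^{(k)}=0$. Assume: (i) there is a finite number $G_1$ such that $\mathbb E_\xi\|\tilde\nabla f(\mathbf x;\xi)\|_1\le G_1$ for all $\mathbf x\in X$; (ii) there is a finite number $G_\infty$ such that $\|\tilde\nabla f(\mathbf x;\xi)\|_\infty\le G_\infty$ for all $\mathbf x\in X$ and almost surely for all $\xi$; (iii) for each $k$, $\mathbf g^{(k)}$ is an unbiased estimate of a subgradient of $F$ at $\widehat{\mathbf x}^{(k)}$, i.e. $\mathbb E[\mathbf g^{(k)}\mid\mathcal H_k]\in\partial F(\widehat{\mathbf x}^{(k)})$, where $\mathcal H_k$ is the $\sigma$-algebra generated by $\{\mathbf x^{(t)}\}_{t\le k}$; (iv) $F$ is $L$-smooth: $\|\nabla F(\mathbf x)-\nabla F(\mathbf y)\|\le L\|\mathbf x-\mathbf y\|$ for all $\mathbf x,\mathbf y\in\mathbb R^n$; (v) there is a finite integer $\tau$ such that the delays satisfy $\tau_k\le\tau$ for all $k\ge1$. Given a positive integer $K$ and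 $\alpha>0$, let $\alpha_k=\frac{\alpha}{\sqrt K}$ for all $1\le k\le K$. Then $$\mathbb E\big[F(\bar{\mathbf x}^{(K)})-F^*\big]\le\frac1{2\alpha\sqrt K(1-\beta_1)}\left(nD_\infty^2G_\infty+\frac{\alpha^2G_1}{(1-\beta_1)^2\sqrt{1-\beta_2}}+\frac{\alpha^3L\tau^2n}{\sqrt K(1-\beta_2)}\right),$$ where $\bar{\mathbf x}^{(K)}$ is drawn from $\{\mathbf x^{(k)}\}_{k=1}^K$ with $$\mathrm{Prob}(\bar{\mathbf x}^{(K)}=\mathbf x^{(k)})=\frac{\sum_{j=k}^K\alpha_j\beta_1^{j-k}}{\sum_{t=1}^K\left(\sum_{j=t}^K\alpha_j\beta_1^{j-t}\right)},\qquad 1\le k\le K.$$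
   Context: Notation: $\|\cdot\|$ is the Euclidean norm. $\tilde\nabla f(\mathbf x;\xi)$ denotes a subgradient of $f(\cdot;\xi)$ at $\mathbf x$ (the gradient if differentiable). Squares, square roots, powers and maxima of vectors are component-wise. For $\mathbf v\ge\mathbf 0$, $\|\mathbf x\|_{\mathbf v}^2=\mathbf x^\top\mathrm{Diag}(\mathbf v)\mathbf x$. Setting: $\xi$ is a random variable and the problem is to minimize $F$ over $X$. Algorithm APAM: choose $\mathbf x^{(1)}\in X$, $\beta_1,\beta_2\in[0,1)$ and step sizes $\{\alpha_k\}$; set $\mathbf m^{(0)}=\mathbf v^{(0)}=\widehat{\mathbf v}^{(0)}=\mathbf 0$. For $k=1,2,\dots$ obtain a (possibly outdated) stochastic gradient $\mathbf g^{(k)}$ and set $$\mathbf m^{(k)}=\beta_1\mathbf m^{(k-1)}+(1-\beta_1)\mathbf g^{(k)},\quad \mathbf v^{(k)}=\beta_2\mathbf v^{(k-1)}+(1-\beta_2)(\mathbf g^{(k)})^2,\quad \widehat{\mathbf v}^{(k)}=\max\{\widehat{\mathbf v}^{(k-1)},\mathbf v^{(k)}\},$$ $$\mathbf x^{(k+1)}\in\operatorname*{Arg\,min}_{\mathbf x\in X}\ \langle\mathbf m^{(k)},\mathbf x\rangle+\frac1{2\alpha_k}\|\mathbf x-\mathbf x^{(k)}\|^2_{\sqrt{\widehat{\mathbf v}^{(k)}}}.$$ Stochastic gradients and delay: $\mathbf g^{(k)}=\frac1{b_k}\sum_{i=1}^{b_k}\tilde\nabla f(\widehat{\mathbf x}^{(k)};\xi_i^{(k)})$,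 where $b_k$ is the number of samples $\xi_i^{(k)}$ of $\xi$. The point $\widehat{\mathbf x}^{(k)}$ is a possibly outdated iterate or a coordinate-wise mixture of iterates: for each coordinate $i$ there is an integer $j\ge0$ with $\widehat x_i^{(k)}=x_i^{(k-j)}$. The delay $\tau_k$ is the smallest integer $\ge 0$ such that every coordinate of $\widehat{\mathbf x}^{(k)}$ equals the corresponding coordinate of one of $\mathbf x^{(k-\tau_k)},\dots,\mathbf x^{(k)}$. *)

(* Defs.v *)
From HB Require Import structures.
From mathcomp Require Import all_boot all_order all_algebra.
From mathcomp Require Import all_classical all_reals all_analysis.
Import Order.TTheory GRing.Theory Num.Theory.
Import numFieldNormedType.Exports.

Set Implicit Arguments.
Unset Strict Implicit.
Unset Printing Implicit Defensive.

Local Open Scope classical_set_scope.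
Local Open Scope ring_scope.

(* Vectors of R^n are row vectors 'rV[R]_n. On this type the library norm `|x| is the
   max-norm; the Euclidean norm and the l1-norm are defined here. *)

Section Vectors.
Context {R : realType} {n : nat}.
Implicit Types (x y v : 'rV[R]_n).

Definition dotv x y : R := \sum_i x 0 i * y 0 i.
Definition norm2 x : R := Num.sqrt (dotv x x).
Definition norm1 x : R := \sum_i `|x 0 i|.

(* ||x||_v^2 = x^T Diag(v) x *)
Definition wnorm_sqr v x : R := \sum_i v 0 i * x 0 i ^+ 2.

Definition box (a b : 'rV[R]_n) : set 'rV[R]_n :=
  [set x | forall i, a 0 i <= x 0 i <= b 0 i].

End Vectors.

Section Extrema.
Context {R : realType}.

Definition argmin {T : Type} (S : set T) (h : T -> R) : set T :=
  [set x | S x /\ forall y, S y -> h x <= h y].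

Definition is_min (S : set R) (m : R) : Prop := S m /\ lbound S m.
Definition is_max (S : set R) (m : R) : Prop := S m /\ ubound S m.

End Extrema.

Section Subgradients.
Context {R : realType} {n : nat}.
Implicit Types (h : 'rV[R]_n -> R) (x v : 'rV[R]_n).

Definition gradient h x : 'rV[R]_n := \row_i 'D_(delta_mx 0 i) (h : _ -> R^o) x.

Definition L_smooth (L : R) h : Prop :=
  (forall x, differentiable (h : _ -> R^o) x) /\
  (forall x y, norm2 (gradient h x - gradient h y) <= L * norm2 (x - y)).

(* the subdifferential of convex analysis *)
Definition subdifferential h x : set 'rV[R]_n :=
  [set v | forall y, h x + dotv v (y - x) <= h y].

(* v is a Clarke generalized gradient: <v, d> <= limsup_(y -> x, t -> 0+) (h(y + t d) - h(y)) / t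
   for every direction d. *)
Definition clarke_subgradient h x v : Prop :=
  forall (d : 'rV[R]_n) (e delta : R), 0 < e -> 0 < delta ->
    exists (y : 'rV[R]_n) (t : R),
      [/\ `|y - x| < delta, 0 < t < delta & t * (dotv v d - e) <= h (y + t *: d) - h y].

(* The functions f(.; xi) need be neither convex nor differentiable. At a point of
   non-differentiability a subgradient is taken in Clarke's sense; for a convex function this
   is membership in [subdifferential]. *)
Definition subgradient h x v : Prop :=
  (differentiable (h : _ -> R^o) x -> v = gradient h x) /\
  (~ differentiable (h : _ -> R^o) x -> clarke_subgradient h x v).

End Subgradients.

Notation borel T := (g_sigma_algebraType (@open T)).

Section Probability.

Context {R : realType} {d : measure_display} {Omega : measurableType d}.
Variable P : probability Omega R.

Definition has_law {d' : measure_display} {T : measurableType d'} (mu : probability T R)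
    (Z : Omega -> T) : Prop :=
  measurable_fun setT Z /\ forall B, measurable B -> P (Z @^-1` B) = mu B.

Definition independent_systems (G1 G2 : set (set Omega)) : Prop :=
  forall A B, G1 A -> G2 B -> P (A `&` B) = (P A * P B)%E.

(* sigma-algebra of the events determined by Z *)
Definition sigma_of {d' : measure_display} {T : measurableType d'} (Z : Omega -> T) :
    set (set Omega) :=
  preimage_set_system setT Z measurable.

Definition random_vector {n : nat} (Z : Omega -> 'rV[R]_n) : Prop :=
  measurable_fun setT (Z : Omega -> borel 'rV[R]_n).

(* sigma-algebra generated by the random vectors x k with 1 <= k <= K *)
Definition history {n : nat} (x : nat -> Omega -> 'rV[R]_n) (K : nat) : set (set Omega) :=
  <<s \bigcup_(k in [set k | (1 <= k <= K)%N]) sigma_of (x k : Omega -> borel 'rV[R]_n) >>.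

(* Y is a version of the conditional expectation of Z given the sub-sigma-algebra G *)
Definition is_cond_expectation (G : set (set Omega)) (Z Y : Omega -> R) : Prop :=
  [/\ forall B, measurable B -> G (Y @^-1` B),
      P.-integrable setT (EFin \o Y) &
      forall A, G A -> (\int[P]_(w in A) (Y w)%:E = \int[P]_(w in A) (Z w)%:E)%E].

End Probability.

Section Apam.
Context {R : realType} {n : nat}.
Variables (X : set 'rV[R]_n) (beta1 beta2 : R) (step : nat -> R).

(* Paths are indexed by nat; the algorithm starts at index 1 and the values of the gradient
   sequence and of the iterates at index 0 are irrelevant. *)
Implicit Types (g x : nat -> 'rV[R]_n) (k : nat).

Fixpoint momentum g k : 'rV[R]_n :=
  if k is k'.+1 then beta1 *: momentum g k' + (1 - beta1) *: g k else 0.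

Fixpoint second_moment g k : 'rV[R]_n :=
  if k is k'.+1 then
    beta2 *: second_moment g k' + (1 - beta2) *: map_mx (fun t => t ^+ 2) (g k)
  else 0.

Fixpoint max_second_moment g k : 'rV[R]_n :=
  if k is k'.+1 then map2_mx Num.max (max_second_moment g k') (second_moment g k) else 0.

(* The second clause of the step resolves the non-uniqueness of the minimizer. *)
Definition apam_path g x : Prop :=
  X (x 1%N) /\
  forall k, (1 <= k)%N ->
    argmin X (fun y => dotv (momentum g k) y
      + (2 * step k)^-1 * wnorm_sqr (map_mx Num.sqrt (max_second_moment g k)) (y - x k))
      (x k.+1) /\
    forall i, max_second_moment g k 0 i = 0 -> x k.+1 0 i = x k 0 i.

(* every coordinate of z is the same coordinate of one of x (k - d), ..., x k *)
Definition within_delay x k (z : 'rV[R]_n) (d : nat) : Prop :=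
  forall i, exists j : nat, [/\ (j <= d)%N, (j < k)%N & z 0 i = x (k - j)%N 0 i].

Definition is_delay x k (z : 'rV[R]_n) (d : nat) : Prop :=
  within_delay x k z d /\ forall d', within_delay x k z d' -> (d <= d')%N.

(* law of the index k for which the output x k is returned after K iterations *)
Definition output_weight (K k : nat) : R :=
  (\sum_(k <= j < K.+1) step j * beta1 ^+ (j - k)) /
  (\sum_(1 <= t < K.+1) \sum_(t <= j < K.+1) step j * beta1 ^+ (j - t)).

End Apam.

Section StochasticGradient.
Context {R : realType} {n : nat} {d d' : measure_display}
  {Omega : measurableType d} {Xi : measurableType d'}.

(* F(x) = E_xi[f(x; xi)] for xi of law mu *)
Definition expected_loss (mu : probability Xi R) (f : 'rV[R]_n -> Xi -> R) (x : 'rV[R]_n) : R :=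
  fine ('E_mu[f x])%E.

Definition minibatch_gradient (sg : 'rV[R]_n -> Xi -> 'rV[R]_n) (bsz : nat -> nat)
    (xi : nat -> nat -> Omega -> Xi) (xhat : nat -> Omega -> 'rV[R]_n)
    (k : nat) (w : Omega) : 'rV[R]_n :=
  (bsz k)%:R^-1 *: \sum_(i < bsz k) sg (xhat k w) (xi k i w).

End StochasticGradient.

(* Main.v *)
From HB Require Import structures.
Require Import Defs.
From mathcomp Require Import all_boot all_order all_algebra.
From mathcomp Require Import all_classical all_reals all_analysis.
From mathcomp Require Import measurable_realfun.
From mathcomp Require Import ring lra.
Import Order.TTheory GRing.Theory Num.Theory.
Import numFieldNormedType.Exports.

Set Implicit Arguments.
Unset Strict Implicit.
Unset Printing Implicit Defensive.

Local Open Scope classical_set_scope.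
Local Open Scope ring_scope.

(* On a box the proximal step splits into coordinates, and coordinatewise everything is
   deterministic. Write s for the step size, q = 1 / sqrt (1 - beta2), c_k = sqrt vhat_k and
   w_k = sum_(k <= j <= K) beta1^(j - k). Since (1 - beta2) g_k^2 <= vhat_k, one gets
   |m_k| <= q c_k, so every step has length at most s q, and the three-point inequality of the
   proximal step gives
     m_k (x_k - u) <= c_k ((x_k - u)^2 - (x_(k+1) - u)^2) / (2 s) + s q |m_k| / 2.
   As c_k is nondecreasing this telescopes. Unrolling
     m_k (x_k - u) = beta1 m_(k-1) (x_(k-1) - u)
                     + (1 - beta1) g_k (x_k - u) + beta1 m_(k-1) (x_k - x_(k-1))
   turns the left-hand side into the weighted sum of the w_k g_k (x_k - u), and
   sum_k |m_k| <= sum_k |g_k|.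
   In expectation g_k may be replaced by the gradient of F at xhat_k, which the delay and the
   step bound place within tau s q of x_k in each coordinate; convexity at xhat_k and the
   descent lemma from xhat_k to x_k then bound E[F(x_k) - F*] by E<g_k, x_k - u> up to
   L n (tau s q)^2 / 2. The output index has law w_k / sum_t w_t, and sum_t w_t >= K. *)

(** * The proximal step in one coordinate *)

Section ScalarStep.
Context {R : realType}.
Implicit Types m c s x y u q : R.

(** Moving from the minimizer [y] towards [u] cannot decrease the objective, so the one-sided
    derivative [A] at [y] is nonnegative. The identity [2 (y - x) (u - y) = (x - u)^2 - (y - u)^2 -
    (y - x)^2] turns this into the claim. *)
Lemma prox_three_point m c s x lo hi y u :
  0 < s -> 0 <= c -> lo <= y <= hi -> lo <= u <= hi ->
  (forall z, lo <= z <= hi ->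
    m * y + (2 * s)^-1 * (c * (y - x) ^+ 2) <=
    m * z + (2 * s)^-1 * (c * (z - x) ^+ 2)) ->
  m * (y - u) <=
  (2 * s)^-1 * (c * ((x - u) ^+ 2 - (y - u) ^+ 2 - (y - x) ^+ 2)).
Proof.
move=> s0 c0 hy hu ymin.
set r := (2 * s)^-1 in ymin *.
have r0 : 0 < r by rewrite invr_gt0 mulr_gt0.
pose A := m * (u - y) + 2 * r * c * (y - x) * (u - y).
pose B := r * c * (u - y) ^+ 2.
have B0 : 0 <= B by rewrite /B mulr_ge0 ?sqr_ge0// mulr_ge0// ltW.
(* The objective at [y + t (u - y)] exceeds the one at [y] by [t (A + t B)]; dividing by [t] keeps
   the sign. *)
have AB t : 0 < t <= 1 -> 0 <= A + t * B.
  move=> /andP[t0 t1].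
  have /ymin : lo <= y + t * (u - y) <= hi by apply/andP; split; nra.
  rewrite -subr_ge0 => le; rewrite -(pmulr_rge0 _ t0).
  by apply: le_trans le _; rewrite le_eqVlt; apply/orP; left; apply/eqP;
    rewrite /A /B; ring.
suff : 0 <= A by rewrite /A; nra.
rewrite leNgt; apply/negP => A0.
(* If [A < 0], moving the fraction [- A / (B - A)] of the way to [u] decreases the objective. *)
have BA : 0 < B - A by lra.
have := AB (- A / (B - A)); rewrite divr_gt0 ?oppr_gt0// ler_pdivrMr// mul1r.
have -> : - A <= B - A by lra.
move=> /(_ isT).
have -> : A + - A / (B - A) * B = - (A ^+ 2 / (B - A)) by field; lra.
rewrite oppr_ge0 leNgt divr_gt0// exprn_even_gt0//=; lra.
Qed.

(** The three-point inequality at [u = x] gives [c / s * e^2 <= |m| e <= q c e] for [e = |y - x|],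
    and [c e] cancels when positive. If [c = 0] the quadratic term is absent, and the rule fixing
    the coordinate gives [y = x]. *)
Lemma prox_step_le m c s q x lo hi y :
  0 < s -> 0 <= c -> `|m| <= q * c -> lo <= y <= hi -> lo <= x <= hi ->
  (forall z, lo <= z <= hi ->
    m * y + (2 * s)^-1 * (c * (y - x) ^+ 2) <=
    m * z + (2 * s)^-1 * (c * (z - x) ^+ 2)) ->
  (c = 0 -> y = x) -> 0 <= q -> `|y - x| <= s * q.
Proof.
move=> s0 c0 mc hy hx /(prox_three_point s0 c0 hy hx) h y0 q0.
have [c00|cn0] := eqVneq c 0; first by rewrite y0// subrr normr0 mulr_ge0// ltW.
have cp : 0 < c by rewrite lt_neqAle eq_sym cn0.
have [->|yx] := eqVneq y x; first by rewrite subrr normr0 mulr_ge0// ltW.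
have e0 : 0 < `|y - x| by rewrite normr_gt0 subr_eq0.
have : c / s * `|y - x| ^+ 2 <= q * c * `|y - x|.
  have : - (m * (y - x)) <= q * c * `|y - x|.
    rewrite (le_trans (ler_norm _))// normrN normrM ler_wpM2r//.
  apply: le_trans; rewrite real_normK ?num_real//.
  rewrite -lerN2 opprK; apply: le_trans h _.
  by rewrite le_eqVlt; apply/orP; left; apply/eqP; field; lra.
rewrite expr2 mulrA ler_pM2r// => h2.
rewrite -(ler_pM2l (divr_gt0 cp s0)); apply: le_trans h2 _.
by rewrite le_eqVlt; apply/orP; left; apply/eqP; field; lra.
Qed.

(** Split [m (x - u) = m (y - u) + m (x - y)]. The term [- (y - x)^2] of the three-point inequality
    absorbs [m (x - y)] up to [s m^2 / (2 c)], and [|m| <= q c] makes this linear in [|m|]. *)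
Lemma prox_step_regret m c s q x lo hi y u :
  0 < s -> 0 <= c -> `|m| <= q * c ->
  lo <= y <= hi -> lo <= u <= hi ->
  (forall z, lo <= z <= hi ->
    m * y + (2 * s)^-1 * (c * (y - x) ^+ 2) <=
    m * z + (2 * s)^-1 * (c * (z - x) ^+ 2)) ->
  (c = 0 -> y = x) -> 0 <= q ->
  m * (x - u) <= (2 * s)^-1 * (c * ((x - u) ^+ 2 - (y - u) ^+ 2))
    + s * q / 2 * `|m|.
Proof.
move=> s0 c0 mc hy hu /(prox_three_point s0 c0 hy hu) h y0 q0.
have key : m * (x - y) - (2 * s)^-1 * (c * (y - x) ^+ 2) <= s * q / 2 * `|m|.
  have [c00|cn0] := eqVneq c 0.
    by rewrite y0// subrr c00 !(mulr0, mul0r) subr0 !mulr_ge0// ltW.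
  have cp : 0 < c by rewrite lt_neqAle eq_sym cn0.
  apply: (@le_trans _ _ (s * m ^+ 2 / (2 * c))).
    rewrite -subr_ge0.
    (* Young's inequality by completing the square. *)
    have -> : s * m ^+ 2 / (2 * c) - (m * (x - y) - (2 * s)^-1 * (c * (y - x) ^+ 2))
      = (s * m - c * (x - y)) ^+ 2 / (2 * s * c).
      by field; rewrite !lt0r_neq0.
    by rewrite divr_ge0 ?sqr_ge0// !mulr_ge0// ltW.
  rewrite ler_pdivrMr ?mulr_gt0// -[m ^+ 2]real_normK ?num_real//.
  have -> : s * q / 2 * `|m| * (2 * c) = s * ((q * c) * `|m|) by field.
  by rewrite ler_pM2l// expr2 ler_wpM2r.
have -> : m * (x - u) = m * (y - u) + m * (x - y) by ring.
have -> : (2 * s)^-1 * (c * ((x - u) ^+ 2 - (y - u) ^+ 2)) =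
  (2 * s)^-1 * (c * ((x - u) ^+ 2 - (y - u) ^+ 2 - (y - x) ^+ 2))
  + (2 * s)^-1 * (c * (y - x) ^+ 2) by ring.
lra.
Qed.

End ScalarStep.

(** * Moment estimates and regret along one coordinate *)

Section ScalarSequences.
Context {R : realType}.

(** The weight [w_k]: for a constant step size, the numerator of [output_weight] divided by that
    step size. *)
Definition geom_tail (b : R) (K k : nat) : R := \sum_(k <= j < K.+1) b ^+ (j - k).

Lemma geom_tail_ge1 b K k : 0 <= b -> (k <= K)%N -> 1 <= geom_tail b K k.
Proof.
move=> b0 kK; rewrite /geom_tail big_ltn ?ltnS// subnn expr0 lerDl.
by apply: sumr_ge0 => j _; rewrite exprn_ge0.
Qed.

Lemma geom_tail_le b K k : 0 <= b < 1 -> geom_tail b K k <= (1 - b)^-1.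
Proof.
move=> /andP[b0 b1]; rewrite /geom_tail.
rewrite -{1}[k]add0n big_addn; under eq_bigr do rewrite addnK.
have b10 : 0 < 1 - b by lra.
rewrite -(ler_pM2l b10) mulfV ?lt0r_neq0//.
rewrite big_mkord -[1 - b]opprB mulNr -subrX1 opprB gerBl exprn_ge0//.
Qed.

(** Unrolled, the recursion lets [B k] enter every later [A j] with factor [b ^+ (j - k)]; summing
    these factors over [j] gives the weight of [B k]. *)
Lemma sum_affine_rec (b : R) (A B : nat -> R) K : A 0%N = 0 ->
  (forall k, (k < K)%N -> A k.+1 = b * A k + B k.+1) ->
  \sum_(1 <= k < K.+1) A k = \sum_(1 <= k < K.+1) geom_tail b K k * B k.
Proof.
move=> A0 hA.
have AE k : (k <= K)%N -> A k = \sum_(1 <= j < k.+1) b ^+ (k - j) * B j.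
  elim: k => [|k IH] kK; first by rewrite A0 big_nil.
  rewrite hA// IH 1?ltnW// [RHS]big_nat_recr//= subnn expr0 mul1r mulr_sumr.
  congr (_ + _); apply: eq_big_nat => j /andP[_ jk].
  by rewrite mulrA -exprS subSn.
rewrite (eq_big_nat _ _ (F2 := fun k => \sum_(1 <= j < k.+1) b ^+ (k - j) * B j)); last first.
  by move=> k /andP[_ kK]; rewrite AE.
rewrite [RHS](eq_bigr (fun k => \sum_(k <= j < K.+1) b ^+ (j - k) * B k)); last first.
  by move=> k _; rewrite /geom_tail mulr_suml.
(* Exchange of the two sums over the triangle [k <= j], by induction on its size. *)
elim: (K) => [|N IH]; first by rewrite !big_nil.
rewrite big_nat_recr//= IH [RHS]big_nat_recr//= big_nat1 subnn.
rewrite [X in _ + X = _]big_nat_recr//= subnn addrA; congr (_ + _).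
rewrite -big_split; apply: eq_big_nat => k /andP[k1 kN].
by rewrite [RHS]big_nat_recr//= ltnW.
Qed.

Variables (b1 b2 : R) (g m v c : nat -> R).
Hypothesis b101 : 0 <= b1 < 1.
Hypothesis b201 : 0 <= b2 < 1.
Hypothesis m0 : m 0%N = 0.
Hypothesis mS : forall k, m k.+1 = b1 * m k + (1 - b1) * g k.+1.
Hypothesis v0 : v 0%N = 0.
Hypothesis vS : forall k, v k.+1 = b2 * v k + (1 - b2) * g k.+1 ^+ 2.
Hypothesis c0 : c 0%N = 0.
Hypothesis cS : forall k, c k.+1 = Num.max (c k) (v k.+1).

Let q : R := (Num.sqrt (1 - b2))^-1.

Lemma second_moment_ge0 k : 0 <= v k.
Proof.
case/andP: b201 => b20 b21.
elim: k => [|k IH]; first by rewrite v0.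
by rewrite vS addr_ge0// mulr_ge0 ?sqr_ge0// subr_ge0 ltW.
Qed.

Lemma max_second_moment_ge0 k : 0 <= c k.
Proof. by elim: k => [|k IH]; rewrite ?c0// cS le_max IH. Qed.

Lemma max_second_moment_nd k : c k <= c k.+1.
Proof. by rewrite cS le_max lexx. Qed.

(** Each [v k.+1] is a convex combination of [v k] and a squared gradient, so it stays below
    [G ^+ 2], and so does the running maximum. *)
Lemma max_second_moment_le G K : 0 <= G -> (forall k, (1 <= k <= K)%N -> `|g k| <= G) ->
  forall k, (k <= K)%N -> Num.sqrt (c k) <= G.
Proof.
move=> G0 hG; case/andP: b201 => b20 b21.
have vG k : (k <= K)%N -> v k <= G ^+ 2.
  elim: k => [|k IH] kK; first by rewrite v0 sqr_ge0.
  have gG : g k.+1 ^+ 2 <= G ^+ 2.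
    by rewrite -real_normK ?num_real// ler_sqr ?nnegrE// hG.
  by have := IH (ltnW kK); rewrite vS; nra.
move=> k kK; rewrite -[leRHS]ger0_norm// -sqrtr_sqr ler_wsqrtr//.
elim: k kK => [|k IH] kK; first by rewrite c0 sqr_ge0.
by rewrite cS ge_max IH 1?ltnW// vG.
Qed.

Let q0 : 0 < q.
Proof. by case/andP: b201 => _ ?; rewrite invr_gt0 sqrtr_gt0 subr_gt0. Qed.

Lemma gradient_le_max_second_moment k : `|g k.+1| <= q * Num.sqrt (c k.+1).
Proof.
case/andP: b201 => b20 b21.
have b2' : 0 < Num.sqrt (1 - b2) by rewrite sqrtr_gt0 subr_gt0.
rewrite /q mulrC ler_pdivlMr// -sqrtr_sqr -sqrtrM ?sqr_ge0// ler_wsqrtr//.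
by rewrite cS le_max vS mulrC lerDr mulr_ge0 ?orbT// second_moment_ge0.
Qed.

(** The new momentum is a convex combination of the old one and the new gradient. Both are bounded
    by [q] times the root of the new maximum, which only grows. *)
Lemma momentum_le_max_second_moment k : `|m k| <= q * Num.sqrt (c k).
Proof.
case/andP: b101 => b10 b11.
elim: k => [|k IH]; first by rewrite m0 c0 sqrtr0 mulr0 normr0.
rewrite mS (le_trans (ler_normD _ _))// !normrM (ger0_norm b10).
rewrite (@ger0_norm _ (1 - b1)) ?subr_ge0 ?(ltW b11)//.
have b1' : 0 <= 1 - b1 by lra.
have h1 := ler_wpM2l b1' (gradient_le_max_second_moment k).
have h2 : q * Num.sqrt (c k) <= q * Num.sqrt (c k.+1).
  by rewrite ler_pM2l// ler_wsqrtr// max_second_moment_nd.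
have h3 := ler_wpM2l b10 (le_trans IH h2).
by apply: le_trans (lerD h3 h1) _; rewrite -mulrDl addrCA subrr addr0 mul1r.
Qed.

Lemma sum_momentum_le K : \sum_(1 <= k < K.+1) `|m k| <= \sum_(1 <= k < K.+1) `|g k|.
Proof.
case/andP: b101 => b10 b11.
(* The extra term makes the bound inductive: [1 + b1 / (1 - b1) = 1 / (1 - b1)]. *)
suff : \sum_(1 <= k < K.+1) `|m k| + b1 / (1 - b1) * `|m K| <= \sum_(1 <= k < K.+1) `|g k|.
  apply: le_trans; rewrite lerDl !mulr_ge0// invr_ge0; lra.
elim: K => [|K IH]; first by rewrite !big_nil m0 normr0 mulr0 addr0.
rewrite big_nat_recr//= [leRHS]big_nat_recr//=.
have b1' : 0 < 1 - b1 by lra.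
have : (1 - b1)^-1 * `|m K.+1| <= b1 / (1 - b1) * `|m K| + `|g K.+1|.
  rewrite mulrC ler_pdivrMr//.
  have -> : (b1 / (1 - b1) * `|m K| + `|g K.+1|) * (1 - b1) =
    b1 * `|m K| + (1 - b1) * `|g K.+1| by field; lra.
  rewrite mS (le_trans (ler_normD _ _))// !normrM (ger0_norm b10).
  by rewrite (@ger0_norm _ (1 - b1)) // ltW.
have -> : (1 - b1)^-1 * `|m K.+1| = `|m K.+1| + b1 / (1 - b1) * `|m K.+1|.
  by field; lra.
by move: IH; lra.
Qed.

Variables (s lo hi D G : R) (x : nat -> R) (K : nat).
Hypothesis s0 : 0 < s.
Hypothesis x1 : lo <= x 1%N <= hi.
Hypothesis xS : forall k, (1 <= k <= K)%N ->
  [/\ lo <= x k.+1 <= hi,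
   forall z, lo <= z <= hi ->
    m k * x k.+1 + (2 * s)^-1 * (Num.sqrt (c k) * (x k.+1 - x k) ^+ 2) <=
    m k * z + (2 * s)^-1 * (Num.sqrt (c k) * (z - x k) ^+ 2) &
   c k = 0 -> x k.+1 = x k].

Lemma iterate_in k : (1 <= k <= K.+1)%N -> lo <= x k <= hi.
Proof. by case: k => // -[//|k] h; have [] := @xS k.+1 h. Qed.

Lemma iterate_step_le k : (1 <= k <= K)%N -> `|x k.+1 - x k| <= s * q.
Proof.
move=> hk; have [h1 h2 h3] := xS hk; have /andP[k1 kK] := hk.
apply: (prox_step_le s0 (sqrtr_ge0 _) (momentum_le_max_second_moment k) h1 _ h2 _ (ltW q0)).
  by apply: iterate_in; rewrite k1 ltnW.
by move/eqP; rewrite sqrtr_eq0 => ck; apply: h3; apply/eqP; rewrite eq_le ck max_second_moment_ge0.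
Qed.

(** Two errors multiply the sum [S] of the [|m k|]: [s q / 2] from the proximal steps and
    [b1 / (1 - b1) * s q] from the motion of the iterates between successive momenta. Together they
    give the factor [s q (1 + b1) / (2 (1 - b1))]. *)
Lemma scalar_regret u : lo <= u <= hi -> (forall k, (1 <= k <= K.+1)%N -> `|x k - u| <= D) ->
  0 <= G -> (forall k, (1 <= k <= K)%N -> `|g k| <= G) ->
  (1 - b1) * \sum_(1 <= k < K.+1) geom_tail b1 K k * (g k * (x k - u)) <=
  (2 * s)^-1 * (G * D ^+ 2) +
  s * q * (1 + b1) / (2 * (1 - b1)) * \sum_(1 <= k < K.+1) `|g k|.
Proof.
move=> hu hD G0 hG; case/andP: (b101) => b10 b11.
pose A k := m k * (x k - u).
(* The inhomogeneous part of the recursion for [A]. At [k = 1] the arbitrary [x 0] appears only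
   multiplied by [m 0 = 0]. *)
pose B k := (1 - b1) * (g k * (x k - u)) + b1 * (m k.-1 * (x k - x k.-1)).
have := @sum_affine_rec b1 A B K; rewrite {1}/A m0 mul0r => /(_ erefl).
have AB k : (k < K)%N -> A k.+1 = b1 * A k + B k.+1.
  by move=> _; rewrite /A /B mS /=; ring.
move=> /(_ AB) sumA {AB}.
pose S := \sum_(1 <= k < K.+1) `|m k|.
have tele : \sum_(1 <= k < K.+1) A k <= (2 * s)^-1 * (G * D ^+ 2) + s * q / 2 * S.
  have : \sum_(1 <= k < K.+1) A k <= (2 * s)^-1 * (Num.sqrt (c K) * D ^+ 2)
     + s * q / 2 * S.
    apply: (@le_trans _ _ (\sum_(1 <= k < K.+1) ((2 * s)^-1 * (Num.sqrt (c k) *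
      ((x k - u) ^+ 2 - (x k.+1 - u) ^+ 2)) + s * q / 2 * `|m k|))).
      apply: ler_sum_nat => k hk; have [h1 h2 h3] := xS hk.
      apply: (prox_step_regret s0 (sqrtr_ge0 _) (momentum_le_max_second_moment k) h1 hu h2 _ (ltW q0)).
      by move/eqP; rewrite sqrtr_eq0 => ck; apply: h3; apply/eqP; rewrite eq_le ck max_second_moment_ge0.
    rewrite big_split/= -!mulr_sumr lerD2r.
    rewrite ler_pM2l ?invr_gt0 ?mulr_gt0//.
    (* The retained last term makes the telescoping inductive: the growth of [Num.sqrt (c N)] then
       multiplies a square that is at most [D ^+ 2]. *)
    suff H N : (N <= K)%N -> \sum_(1 <= k < N.+1) Num.sqrt (c k) *
        ((x k - u) ^+ 2 - (x k.+1 - u) ^+ 2) <=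
        Num.sqrt (c N) * D ^+ 2 - Num.sqrt (c N) * (x N.+1 - u) ^+ 2.
      by apply: (le_trans (H K (leqnn _))); rewrite gerBl mulr_ge0// sqr_ge0.
    elim: N => [|N IH] NK; first by rewrite big_nil c0 sqrtr0 !mul0r subrr.
    rewrite big_nat_recr//= (le_trans (lerD (IH (ltnW NK)) (lexx _)))//.
    have cc : Num.sqrt (c N) <= Num.sqrt (c N.+1).
      by rewrite ler_wsqrtr// max_second_moment_nd.
    have : (x N.+1 - u) ^+ 2 <= D ^+ 2.
      have hN : `|x N.+1 - u| <= D by apply: hD; rewrite /= ltnW.
      have D0 : 0 <= D := le_trans (normr_ge0 _) hN.
      by rewrite -(real_normK (num_real (x N.+1 - u))) ler_sqr ?nnegrE.
    by nra.
  move=> /le_trans; apply; rewrite lerD2r ler_pM2l ?invr_gt0 ?mulr_gt0//.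
  rewrite ler_wpM2r ?sqr_ge0// (max_second_moment_le _ hG)//.
(* The weight is at most [(1 - b1)^-1] and each step at most [s q]. The shifted sum starts with
   [m 0 = 0] and omits [|m K|], so it is at most [S]. *)
have low : - (b1 / (1 - b1) * (s * q) * S) <=
    \sum_(1 <= k < K.+1) geom_tail b1 K k * (b1 * (m k.-1 * (x k - x k.-1))).
  apply: (@le_trans _ _ (\sum_(1 <= k < K.+1) - (b1 / (1 - b1) * (s * q) * `|m k.-1|))).
    rewrite sumrN -mulr_sumr lerN2 ler_wpM2l//.
      by rewrite !mulr_ge0// ?invr_ge0 ?subr_ge0// ltW.
    rewrite big_add1/= /S; case: (K) => [|N]; first by rewrite !big_nil.
    by rewrite big_ltn// m0 normr0 add0r [leRHS]big_nat_recr//= lerDl.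
  apply: ler_sum_nat => -[//|k] /andP[_ kK] /=.
  rewrite -lerN2 opprK (le_trans (ler_norm _))// normrN !normrM.
  have gt0 : 0 <= geom_tail b1 K k.+1 by rewrite (le_trans ler01)// geom_tail_ge1.
  rewrite (ger0_norm gt0) (ger0_norm b10).
  have -> : b1 / (1 - b1) * (s * q) * `|m k| = (1 - b1)^-1 * (b1 * (`|m k| * (s * q))) by ring.
  rewrite ler_pM// ?mulr_ge0// ?geom_tail_le//.
  rewrite ler_wpM2l//; case: k kK {gt0} => [|k] kK; first by rewrite m0 normr0 !mul0r.
  by rewrite ler_wpM2l// iterate_step_le//= ltnW.
have S_le : S <= \sum_(1 <= k < K.+1) `|g k| by exact: sum_momentum_le.
have -> : (1 - b1) * \sum_(1 <= k < K.+1) geom_tail b1 K k * (g k * (x k - u)) =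
  \sum_(1 <= k < K.+1) A k -
    \sum_(1 <= k < K.+1) geom_tail b1 K k * (b1 * (m k.-1 * (x k - x k.-1))).
  rewrite sumA -sumrB mulr_sumr; apply: eq_bigr => k _; rewrite /B; ring.
have : s * q * (1 + b1) / (2 * (1 - b1)) * S <=
       s * q * (1 + b1) / (2 * (1 - b1)) * \sum_(1 <= k < K.+1) `|g k|.
  by rewrite ler_wpM2l// divr_ge0// !mulr_ge0// ?(ltW s0) ?(ltW q0)//; lra.
have -> : s * q * (1 + b1) / (2 * (1 - b1)) * S =
  s * q / 2 * S + b1 / (1 - b1) * (s * q) * S by field; lra.
lra.
Qed.

End ScalarSequences.

(** * Smooth functions *)

Section Dotv.
Context {R : realType} {n : nat}.
Implicit Types (x y z : 'rV[R]_n) (h : 'rV[R]_n -> R).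

Lemma dotvBl x y z : dotv (x - y) z = dotv x z - dotv y z.
Proof. by rewrite /dotv -sumrB; apply: eq_bigr => i _; rewrite !mxE mulrBl. Qed.

Lemma dotvBr x y z : dotv x (y - z) = dotv x y - dotv x z.
Proof. by rewrite /dotv -sumrB; apply: eq_bigr => i _; rewrite !mxE mulrBr. Qed.

Lemma dotvZr (t : R) x y : dotv x (t *: y) = t * dotv x y.
Proof. by rewrite /dotv mulr_sumr; apply: eq_bigr => i _; rewrite !mxE mulrCA. Qed.

Lemma dotvZl (t : R) x y : dotv (t *: x) y = t * dotv x y.
Proof. by rewrite /dotv mulr_sumr; apply: eq_bigr => i _; rewrite !mxE mulrA. Qed.

Lemma dotvC x y : dotv x y = dotv y x.
Proof. by apply: eq_bigr => i _; rewrite mulrC. Qed.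

Lemma dotvv_ge0 x : 0 <= dotv x x.
Proof. by apply: sumr_ge0 => i _; rewrite -expr2 sqr_ge0. Qed.

Lemma norm2_ge0 x : 0 <= norm2 x. Proof. exact: sqrtr_ge0. Qed.

Lemma norm2_sqr x : norm2 x ^+ 2 = dotv x x.
Proof. by rewrite sqr_sqrtr// dotvv_ge0. Qed.

Lemma norm2Z (t : R) x : norm2 (t *: x) = `|t| * norm2 x.
Proof. by rewrite /norm2 dotvZl dotvZr mulrA -expr2 sqrtrM ?sqr_ge0// sqrtr_sqr. Qed.

(** Cauchy-Schwarz, from the nonnegative square of [norm2 y *: x - norm2 x *: y]. Cancelling the
    product of the norms requires treating zero norms apart. *)
Lemma dotv_le x y : dotv x y <= norm2 x * norm2 y.
Proof.
have [x0|xn0] := eqVneq (norm2 x) 0.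
  have xi i : x 0 i = 0.
    have : dotv x x == 0 by rewrite -norm2_sqr x0 expr0n.
    rewrite psumr_eq0 => [|j _]; last by rewrite -expr2 sqr_ge0.
    by move=> /allP/(_ i (mem_index_enum _)); rewrite -expr2 sqrf_eq0 => /eqP.
  by rewrite x0 mul0r /dotv big1// => i _; rewrite xi mul0r.
have xp : 0 < norm2 x by rewrite lt_neqAle eq_sym xn0 norm2_ge0.
have [y0|yn0] := eqVneq (norm2 y) 0.
  have yi i : y 0 i = 0.
    have : dotv y y == 0 by rewrite -norm2_sqr y0 expr0n.
    rewrite psumr_eq0 => [|j _]; last by rewrite -expr2 sqr_ge0.
    by move=> /allP/(_ i (mem_index_enum _)); rewrite -expr2 sqrf_eq0 => /eqP.
  by rewrite y0 mulr0 /dotv big1// => i _; rewrite yi mulr0.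
have yp : 0 < norm2 y by rewrite lt_neqAle eq_sym yn0 norm2_ge0.
have := dotvv_ge0 (norm2 y *: x - norm2 x *: y).
rewrite !(dotvBl, dotvBr) !dotvZl !dotvZr -!norm2_sqr (dotvC y x).
set X := norm2 x in xp *; set Y := norm2 y in yp *; set D := dotv x y => H.
have XY : 0 < X * Y by rewrite mulr_gt0.
rewrite -(ler_pM2l XY); nra.
Qed.

(** The difference quotient of the restriction is that of the directional derivative along [y];
    linearity of the differential expands it over the standard basis. *)
Lemma is_derive_line h x y (t : R) :
  differentiable (h : _ -> R^o) (x + t *: y) ->
  is_derive t 1 (fun s : R => h (x + s *: y) : R^o) (dotv (gradient h (x + t *: y)) y).
Proof.
move=> dh.
have E : (fun s : R => s^-1 *: (((fun s : R => h (x + s *: y) : R^o) \o shift t) (s *: 1) -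
     h (x + t *: y)) : R^o) =
  (fun s : R => s^-1 *: (((h : _ -> R^o) \o shift (x + t *: y)) (s *: y) - h (x + t *: y))).
  apply/funext => s /=; congr (_ *: (h _ - _)).
  by rewrite [s *: 1]mulr1 scalerDl addrCA.
have dv : derivable (h : _ -> R^o) (x + t *: y) y by exact: diff_derivable.
apply: DeriveDef; first by rewrite /derivable E.
rewrite /derive E -/(derive (h : _ -> R^o) (x + t *: y) y) deriveE//.
rewrite [X in 'd _ _ X]row_sum_delta linear_sum /dotv; apply: eq_bigr => i _.
by rewrite linearZ /= mxE deriveE// mulrC.
Qed.

(** Along the axis [i], the function [h (x + s *: d) - v 0 i * s] is minimal at [s = 0], so its
    derivative there, the difference of the two coordinates, vanishes. *)
Lemma subdifferential_gradient h x v : (forall y, differentiable (h : _ -> R^o) y) ->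
  subdifferential h x v -> v = gradient h x.
Proof.
move=> dh hv; apply/rowP => i.
pose d : 'rV[R]_n := delta_mx 0 i.
have dotd y : dotv y d = y 0 i.
  rewrite /dotv (bigD1 i)//= big1 => [|j ji]; first by rewrite !mxE !eqxx mulr1 addr0.
  by rewrite mxE (negbTE ji) andbF mulr0.
pose p : {poly R} := v 0 i *: 'X.
pose phi : R -> R^o := (fun s : R => h (x + s *: d) : R^o) - (horner p : R -> R^o).
have dphi : is_derive (0 : R) (1 : R) phi (gradient h x 0 i - v 0 i).
  have -> : v 0 i = p^`().[0] by rewrite /p derivZ derivX !hornerE.
  rewrite -dotd -[in gradient h x](addr0 x) -(scale0r d).
  by apply: is_deriveB; apply: is_derive_line; rewrite scale0r addr0.
have p0 : (0 : R) \in `](-1 : R), 1[%R by rewrite in_itv /= ltrN10 ltr01.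
have : is_derive (0 : R) (1 : R) (phi : R -> R) 0.
  apply: (derive1_at_min _ _ p0) => [|t _|t _]; first by lra.
    apply: derivableB; last by have [] := is_derive_poly p t.
    by have [] := is_derive_line (dh (x + t *: d)).
  rewrite /phi /p !fctE /= scale0r addr0 !hornerE.
  have := hv (x + t *: d); rewrite (addrAC x) subrr add0r dotvZr dotd; lra.
move=> /@derive_val; have := @derive_val _ _ _ _ _ _ _ dphi; move=> -> /eqP.
by rewrite subr_eq0 => /eqP ->.
Qed.

(** Subtract the quadratic model from [h] along the segment. By Cauchy-Schwarz and the Lipschitz
    gradient the difference has nonpositive derivative, and the mean value theorem on [[0, 1]]
    concludes. *)
Lemma descent_lemma (L : R) h x y : L_smooth L h ->
  h y <= h x + dotv (gradient h x) (y - x) + L / 2 * norm2 (y - x) ^+ 2.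
Proof.
move=> [dh Lh]; set d := y - x.
pose p : {poly R} := dotv (gradient h x) d *: 'X + (L / 2 * norm2 d ^+ 2) *: 'X^2.
pose phi : R -> R^o := (fun s : R => h (x + s *: d) : R^o) - (horner p : R -> R^o).
pose dphi (t : R) := dotv (gradient h (x + t *: d)) d
   - (dotv (gradient h x) d + L * norm2 d ^+ 2 * t).
have dphiP t : is_derive t (1 : R) phi (dphi t).
  have -> : dphi t = dotv (gradient h (x + t *: d)) d - p^`().[t].
    by rewrite /dphi /p derivD !derivZ derivX derivXn !hornerE /=; field.
  by apply: is_deriveB; exact: is_derive_line.
have [|t t01] := @MVT R phi dphi 0 1 ltr01 (fun t _ => dphiP t).
  by apply: derivable_within_continuous => t _; have [] := dphiP t.
have -> : phi 1 - phi 0 = h y - h x - dotv (gradient h x) d - L / 2 * norm2 d ^+ 2.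
  rewrite /phi /p /= !fctE /= scale1r scale0r /d addr0 [x + _]addrC subrK !hornerE /=; ring.
rewrite subr0 mulr1 => E.
suff : dphi t <= 0 by rewrite -E; lra.
move: t01; rewrite in_itv /= => /andP[t0 _].
rewrite /dphi opprD addrA -dotvBl subr_le0 (le_trans (dotv_le _ _))//.
rewrite expr2 mulrAC mulrA ler_wpM2r ?norm2_ge0//.
apply: le_trans (Lh _ _) _.
by rewrite addrC addKr norm2Z gtr0_norm// mulrA mulrAC.
Qed.

(** Two distinct points, [x] and [0], force the sign of [L]; in dimension 0 there are none. *)
Lemma L_smooth_ge0 (L : R) h x : L_smooth L h -> x != 0 -> 0 <= L.
Proof.
move=> [_ Lh] x0; have := le_trans (norm2_ge0 _) (Lh x 0); rewrite subr0 pmulr_lge0//.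
rewrite lt_neqAle norm2_ge0 andbT eq_sym.
apply: contra x0 => /eqP h0; apply/eqP/rowP => i; rewrite mxE.
have : dotv x x == 0 by rewrite -norm2_sqr h0 expr0n.
rewrite psumr_eq0 => [|j _]; last by rewrite -expr2 sqr_ge0.
by move=> /allP/(_ i (mem_index_enum _)); rewrite -expr2 sqrf_eq0 => /eqP.
Qed.
End Dotv.

(** * Integration *)

Section RealIntegral.
Context {R : realType} {d : measure_display} {T : measurableType d}.
Variable P : probability T R.
Implicit Types f g Z U : T -> R.

Local Notation integrableR f := (P.-integrable setT (EFin \o f)).
Local Notation E f := (Rintegral P setT f).

Lemma integrable_bounded f (M : R) : measurable_fun setT f ->
  (forall w, `|f w| <= M) -> integrableR f.
Proof.
move=> mf fM; apply: (@le_integrable _ _ _ _ _ measurableT _ (EFin \o cst M)).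
- exact/measurable_EFinP.
- move=> w _ /=; rewrite lee_fin (le_trans (fM w))// ler_norm//.
- exact: finite_measure_integrable_cst.
Qed.

Lemma integrable_measurable f : integrableR f -> measurable_fun setT f.
Proof. by move=> /measurable_int /measurable_EFinP. Qed.

Lemma integrableR_D f g : integrableR f -> integrableR g ->
  integrableR (fun w => f w + g w).
Proof. by move=> fi gi; have := integrableD measurableT fi gi. Qed.

Lemma integrableR_B f g : integrableR f -> integrableR g ->
  integrableR (fun w => f w - g w).
Proof. by move=> fi gi; have := integrableB measurableT fi gi. Qed.

Lemma integrableR_Z (c : R) f : integrableR f -> integrableR (fun w => c * f w).
Proof. by move=> fi; have := integrableZl measurableT c fi. Qed.

Lemma integrableR_mul f Z (M : R) : integrableR f -> measurable_fun setT Z ->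
  (forall w, `|Z w| <= M) -> integrableR (fun w => f w * Z w).
Proof.
move=> fi mZ ZM; have mf := integrable_measurable fi.
apply: (@le_integrable _ _ _ _ _ measurableT _ (fun w => M%:E * (EFin \o f) w)%E).
- exact/measurable_EFinP/measurable_funM.
- move=> w _ /=; rewrite lee_fin normrM mulrC.
  have M0 : 0 <= M := le_trans (normr_ge0 _) (ZM w).
  by rewrite normrM (ger0_norm M0) ler_wpM2r.
- exact: integrableZl.
Qed.

Lemma integrableR_sum (I : eqType) (s : seq I) (f : I -> T -> R) :
  (forall i, i \in s -> integrableR (f i)) -> integrableR (fun w => \sum_(i <- s) f i w).
Proof.
elim: s => [|i s IH] h.
  have -> : (fun w => \sum_(i <- [::]) f i w) = cst 0.
    by apply/funext => w; rewrite big_nil.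
  exact: finite_measure_integrable_cst.
have -> : (fun w => \sum_(i <- i :: s) f i w) = (fun w => f i w + \sum_(j <- s) f j w).
  by apply/funext => w; rewrite big_cons.
apply: integrableR_D; first by apply: h; rewrite mem_head.
by apply: IH => j js; apply: h; rewrite in_cons js orbT.
Qed.

Lemma Rintegral_sum (I : eqType) (s : seq I) (f : I -> T -> R) :
  (forall i, i \in s -> integrableR (f i)) ->
  E (fun w => \sum_(i <- s) f i w) = \sum_(i <- s) E (f i).
Proof.
elim: s => [|i s IH] h.
  have -> : (fun w => \sum_(i <- [::]) f i w) = cst 0.
    by apply/funext => w; rewrite big_nil.
  by rewrite big_nil Rintegral_cst// mul0r.
have -> : (fun w => \sum_(i <- i :: s) f i w) = (fun w => f i w + \sum_(j <- s) f j w).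
  by apply/funext => w; rewrite big_cons.
have hs j : j \in s -> integrableR (f j).
  by move=> js; apply: h; rewrite in_cons js orbT.
rewrite RintegralD ?IH ?big_cons//; last exact: integrableR_sum.
by apply: h; rewrite mem_head.
Qed.

Lemma ae_le_Rintegral f g : integrableR f -> integrableR g ->
  {ae P, forall w, f w <= g w} -> E f <= E g.
Proof.
move=> fi gi fg.
have hi : integrableR (fun w => g w - f w) by exact: integrableR_B.
rewrite -subr_ge0 -RintegralB//.
(* Almost everywhere the difference equals its absolute value, which is nonnegative at every
   point. *)
suff -> : E (fun w => g w - f w) = E (fun w => `|g w - f w|) by exact: Rintegral_ge0.
congr fine; apply: ae_eq_integral => //.
- exact: measurable_int hi.
- exact/measurable_EFinP/measurableT_comp/integrable_measurable/hi.
- by apply: filterS fg => w fg _ /=; rewrite ger0_norm// subr_ge0.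
Qed.

(** The sum counts the integers among [1, ..., N] that are at most [y], hence is the smaller of [N]
    and the integer part of [y]. The saturated case drives the induction for the other one. *)
Lemma staircase_bounds (N : nat) (y : R) : 0 <= y ->
  (N%:R <= y -> \sum_(i < N) ((i.+1)%:R <= y)%R%:R = N%:R :> R) /\
  (y <= N%:R -> y - 1 <= \sum_(i < N) ((i.+1)%:R <= y)%R%:R <= y).
Proof.
move=> y0; elim: N => [|N [IH1 IH2]].
  by rewrite big_ord0; split => // y0'; apply/andP; split; lra.
rewrite big_ord_recr /=; split=> h.
  rewrite h IH1 ?natr1//; apply: le_trans h; by rewrite ler_nat.
have [h'|h'] := leP N.+1%:R y.
  have e : y = N.+1%:R by apply/eqP; rewrite eq_le h h'.
  rewrite IH1; last by rewrite e ler_nat.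
  by rewrite natr1 e lexx gerBl ler01.
rewrite addr0; have [yN|yN] := leP y N%:R; first exact: IH2.
move: h'; rewrite (IH1 (ltW yN)) -natr1 => h'; apply/andP; split; lra.
Qed.

(* [Z] is approximated from below by the staircase
   [lo + w / N * #{i < N | lo + w * (i + 1) / N <= Z}], within [w / N]. *)
Lemma Rintegral_mul_eq0 (G : set (set T)) U Z (lo w : R) :
  G `<=` measurable -> G setT -> integrableR U ->
  (forall A, G A -> E (fun t => U t * \1_A t) = 0) ->
  measurable_fun setT Z -> (forall t, G [set s | t <= Z s]) ->
  (forall t, lo <= Z t <= lo + w) -> E (fun t => U t * Z t) = 0.
Proof.
move=> Gm GT Ui UG mZ GZ Zb.
have [[t0 _]|/set0P/negP/negPn/eqP T0] := pselect (@setT T !=set0); last first.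
  by rewrite T0 Rintegral_set0.
(* For [w <= 0] the function [Z] is the constant [lo], and the hypothesis on the whole space
   suffices. *)
have [w0 | wp] := leP w 0.
  have -> : (fun t => U t * Z t) = (fun t => lo * (U t * \1_setT t)).
    apply/funext => t; rewrite indicT mulr1 mulrC; congr (_ * _).
    by apply/eqP; rewrite eq_le; have := Zb t; lra.
  rewrite RintegralZl ?UG ?mulr0//; first by under eq_fun do rewrite indicT mulr1.
pose A (N : nat) (i : 'I_N) := [set s | lo + w * i.+1%:R / N%:R <= Z s].
pose ZN (N : nat) t := lo * \1_setT t + w / N%:R * \sum_(i < N) \1_(A N i) t.
have mA N i : measurable (A N i) by apply: Gm; exact: GZ.
have bA (B : set T) t : `|\1_B t : R| <= 1.
  by rewrite indicE; case: (_ \in _); rewrite ?normr1 ?normr0.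
have UAi B : measurable B -> integrableR (fun t => U t * \1_B t).
  by move=> mB; apply: (@integrableR_mul _ _ 1).
have ZNE N : E (fun t => U t * ZN N t) = 0 /\ integrableR (fun t => U t * ZN N t).
  have -> : (fun t => U t * ZN N t) = (fun t => lo * (U t * \1_setT t) +
     w / N%:R * \sum_(i <- index_enum 'I_N) U t * \1_(A N i) t).
    apply/funext => t; rewrite /ZN mulrDr mulrCA; congr (_ + _).
    rewrite mulrCA; congr (_ * _).
    by rewrite mulr_sumr.
  have i1 : integrableR (fun t => lo * (U t * \1_setT t)).
    by apply: integrableR_Z; exact: UAi.
  have i2 : integrableR (fun t => \sum_(i <- index_enum 'I_N) U t * \1_(A N i) t).
    by apply: integrableR_sum => i _; exact: UAi.
  have i3 : integrableR (fun t => w / N%:R * \sum_(i <- index_enum 'I_N) U t * \1_(A N i) t).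
    exact: integrableR_Z.
  split; last exact: integrableR_D.
  rewrite RintegralD// RintegralZl//; last exact: UAi.
  rewrite RintegralZl// Rintegral_sum => [|i _]; last exact: UAi.
  rewrite UG// big1 ?mulr0 ?addr0// => i _; apply: UG; exact: GZ.
have ZNb N t : (0 < N)%N -> `|Z t - ZN N t| <= w / N%:R.
  move=> N0; have N0' : 0 < N%:R :> R by rewrite ltr0n.
  have [|_] := @staircase_bounds N ((Z t - lo) * N%:R / w).
    by rewrite divr_ge0 ?(ltW wp)// mulr_ge0// subr_ge0; have /andP[] := Zb t.
  have -> : \sum_(i < N) ((i.+1)%:R <= (Z t - lo) * N%:R / w)%R%:R = \sum_(i < N) \1_(A N i) t :> R.
    apply: eq_bigr => i _; rewrite indicE; congr (nat_of_bool _)%:R.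
    rewrite /A; apply/idP/idP; rewrite inE/= ler_pdivlMr//.
      move=> h; rewrite -lerBrDl ler_pdivrMr// mulrC//.
    by rewrite -lerBrDl ler_pdivrMr// mulrC.
  rewrite /ZN indicT mulr1; set S := \sum_(i < N) _; set y := _ * _ / w.
  have wN : 0 < w / N%:R by rewrite divr_gt0.
  have -> : Z t - (lo + w / N%:R * S) = (y - S) * (w / N%:R).
    by rewrite /y; field; rewrite !gt_eqF.
  move=> yS; have /andP[yS0 yS1] : 0 <= y - S <= 1.
    have : y <= N%:R; last by move=> /yS /andP[? ?]; apply/andP; split; lra.
    by rewrite /y ler_pdivrMr// mulrC ler_pM2l//; have := Zb t; lra.
  rewrite ger0_norm; last by rewrite mulr_ge0 ?(ltW wN).
  by rewrite -[leRHS]mul1r ler_pM2r.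
have Zi : integrableR (fun t => U t * Z t).
  apply: (@integrableR_mul _ _ (`|lo| + w)) => // t.
  have /andP[h1 h2] := Zb t; have h3 := ler_norm lo.
  have h4 : - lo <= `|lo| by rewrite -normrN ler_norm.
  by rewrite ler_norml; apply/andP; split; lra.
have aUi : integrableR (fun t => `|U t|).
  have := integrable_abse Ui; apply: eq_integrable => //.
apply/eqP; rewrite -normr_le0 leNgt; apply/negP => h.
(* Were the integral nonzero, this [N] would make the approximation error [w / N * E |U|] smaller
   than its absolute value. *)
pose N := (Num.bound `|w * E (fun t => `|U t|) / `|E (fun t => U t * Z t)| |).+1.
have : w * E (fun t => `|U t|) / `|E (fun t => U t * Z t)| < N%:R.
  apply: le_lt_trans (ler_norm _) _.
  apply: lt_le_trans (archi_boundP (normr_ge0 _)) _.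
  by rewrite ler_nat.
rewrite ltr_pdivrMr// ltNge => /negP; apply.
have [ZN0 ZNi] := ZNE N.
have -> : E (fun t => U t * Z t) = E (fun t => U t * (Z t - ZN N t)).
  under [RHS]eq_Rintegral do rewrite mulrBr.
  by rewrite RintegralB// ZN0 subr0.
have di : integrableR (fun t => U t * (Z t - ZN N t)).
  have := integrableR_B Zi ZNi; apply: eq_integrable => // t _ /=.
  by rewrite mulrBr.
rewrite mulrC -ler_pdivlMr ?ltr0n//.
apply: le_trans (le_normr_Rintegral measurableT di) _.
rewrite mulrAC -RintegralZl//; apply: le_Rintegral => //.
- by have := integrable_abse di; apply: eq_integrable.
- exact: integrableR_Z.
- by move=> t _; rewrite normrM mulrC ler_wpM2r// ZNb.
Qed.

End RealIntegral.

(** * Borel functions of vectors *)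

Section BorelVectors.
Context {R : realType} {n : nat}.

Lemma continuous_borel_measurable (h : 'rV[R]_n -> R) :
  continuous h -> measurable_fun setT (h : borel 'rV[R]_n -> R).
Proof.
move=> /continuousP ch; apply: (measurability _ (RGenOpens.measurableE R)).
move=> _ [_ [a [b ->] <-]]; rewrite setTI.
by apply: sub_sigma_algebra; exact/ch/interval_open.
Qed.

Lemma coord_measurable i : measurable_fun setT (fun v : borel 'rV[R]_n => (v : 'rV[R]_n) 0 i).
Proof. by apply: continuous_borel_measurable; exact: coord_continuous. Qed.

Lemma maxnorm_measurable : measurable_fun setT (fun v : borel 'rV[R]_n => `|v : 'rV[R]_n|).
Proof. by apply: continuous_borel_measurable; exact: norm_continuous. Qed.

Lemma norm1_measurable : measurable_fun setT (@norm1 R n : borel 'rV[R]_n -> R).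
Proof.
rewrite /norm1; apply: measurable_sum => i; apply: measurableT_comp => //.
exact: coord_measurable.
Qed.

End BorelVectors.

(** * Integrating over one of two independent variables *)

Section Freezing.
Context {R : realType} {d d1 d2 : measure_display} {T : measurableType d}
  {T1 : measurableType d1} {T2 : measurableType d2}.
Variables (P : probability T R) (mu : probability T2 R) (Z1 : T -> T1) (Z2 : T -> T2).
Local Open Scope ereal_scope.

(* Fubini for the joint law of [Z1] and [Z2], which independence makes a product. *)
Lemma independent_integral (h : T1 * T2 -> \bar R) :
  measurable_fun setT Z1 -> has_law P mu Z2 ->
  independent_systems P (sigma_of Z2) (sigma_of Z1) ->
  measurable_fun setT h -> (forall p, 0 <= h p) ->
  \int[P]_w h (Z1 w, Z2 w) = \int[P]_w \int[mu]_z h (Z1 w, z).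
Proof.
move=> mZ1 [mZ2 lawZ2] ind mh h0.
pose Z1m : {mfun T >-> T1} := HB.pack Z1 (isMeasurableFun.Build _ _ _ _ _ mZ1).
have mZ : measurable_fun setT (fun w => (Z1 w, Z2 w)) by exact: measurable_fun_pair.
pose Zm : {mfun T >-> (T1 * T2)%type} :=
  HB.pack (fun w => (Z1 w, Z2 w)) (isMeasurableFun.Build _ _ _ _ _ mZ).
have joint A : measurable A -> (distribution P Z1m \x mu) A = distribution P Zm A.
  apply: product_measure_unique => B C mB mC.
  transitivity (P (Z2 @^-1` C `&` Z1 @^-1` B)).
    by congr (P _); apply/seteqP; split => w /= [].
  change (P (Z2 @^-1` C `&` Z1 @^-1` B) = P (Z1 @^-1` B) * mu C).
  rewrite ind ?lawZ2 1?muleC//.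
  - by exists C => //; rewrite setTI.
  - by exists B => //; rewrite setTI.
rewrite -(ge0_integral_distribution Zm mh h0).
rewrite -(eq_measure_integral _ (fun A mA _ => joint A mA)) fubini_tonelli1//.
rewrite ge0_integral_distribution//.
- exact: measurable_fun_fubini_tonelli_F.
- by move=> y; apply: integral_ge0.
Qed.

End Freezing.

(** * Events determined by the past iterates *)

Section History.
Context {R : realType} {d : measure_display} {T : measurableType d} {n : nat}.
Variables (x : nat -> T -> 'rV[R]_n) (K : nat).

Lemma historyT : history x K setT.
Proof.
rewrite -setC0 -setTD; apply: sigma_algebraCD; exact: sigma_algebra0.
Qed.

Lemma history_measurable : (forall k, (1 <= k)%N -> random_vector (x k)) ->
  history x K `<=` measurable.
Proof.
move=> mx; apply: smallest_sub; first exact: sigma_algebra_measurable.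
move=> A [k /= /andP[k1 _] [B mB <-]]; exact: mx.
Qed.

Lemma history_preimage (h : 'rV[R]_n -> R) (B : set R) k : (1 <= k <= K)%N ->
  measurable_fun setT (h : borel 'rV[R]_n -> R) -> measurable B ->
  history x K [set w | B (h (x k w))].
Proof.
move=> kK mh mB; apply: sub_sigma_algebra; exists k => //=.
exists (h @^-1` B); last by rewrite setTI.
by rewrite -[X in measurable X]setTI; exact: mh.
Qed.

Lemma history_ge (h : 'rV[R]_n -> R) (t : R) k : (1 <= k <= K)%N ->
  measurable_fun setT (h : borel 'rV[R]_n -> R) ->
  history x K [set w | t <= h (x k w)].
Proof.
move=> kK mh; have := history_preimage kK mh (measurable_itv `[t, +oo[).
by congr (history _ _ _); apply/funext => w /=; rewrite in_itv /= andbT.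
Qed.

End History.

(** * Paths of the algorithm *)

Section MaxNorm.
Context {R : realType} {n : nat}.
Implicit Types v : 'rV[R]_n.

Lemma coord_le_norm v i : `|v 0 i| <= `|v|.
Proof. by rewrite [leRHS]/Num.Def.normr /= mx_normrE; apply/bigmax_geP; right => /=; exists (0, i). Qed.

Lemma norm2_sqr_le v (M : R) : (forall i, `|v 0 i| <= M) -> norm2 v ^+ 2 <= n%:R * M ^+ 2.
Proof.
move=> vM; rewrite norm2_sqr /dotv.
apply: (@le_trans _ _ (\sum_(i < n) M ^+ 2)); last by rewrite sumr_const card_ord mulr_natl.
apply: ler_sum => i _; rewrite -expr2 -(real_normK (num_real _)).
by rewrite ler_sqr ?nnegrE// (le_trans _ (vM i)).
Qed.

Lemma norm1_ge0 v : 0 <= norm1 v.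
Proof. by apply: sumr_ge0. Qed.

End MaxNorm.

Section ApamPath.
Context {R : realType} {n : nat}.
Variables (a b : 'rV[R]_n) (b1 b2 : R) (step : nat -> R).
Variables (g x : nat -> 'rV[R]_n) (K : nat) (s : R).
Hypothesis b101 : 0 <= b1 < 1.
Hypothesis b201 : 0 <= b2 < 1.
Hypothesis hpath : apam_path (box a b) b1 b2 step g x.
Hypothesis s0 : 0 < s.
Hypothesis hstep : forall k, (1 <= k <= K)%N -> step k = s.

Let q : R := (Num.sqrt (1 - b2))^-1.

Lemma apam_path_in k : (1 <= k)%N -> box a b (x k).
Proof.
case: hpath => x1 xS; case: k => [//|[//|k] _].
by have [[]] := xS k.+1 isT.
Qed.

Let m0 i : momentum b1 g 0 0 i = 0. Proof. by rewrite mxE. Qed.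

Let mS i k : momentum b1 g k.+1 0 i = b1 * momentum b1 g k 0 i + (1 - b1) * g k.+1 0 i.
Proof. by rewrite /= !mxE. Qed.

Let v0 i : second_moment b2 g 0 0 i = 0. Proof. by rewrite mxE. Qed.

Let vS i k : second_moment b2 g k.+1 0 i =
  b2 * second_moment b2 g k 0 i + (1 - b2) * g k.+1 0 i ^+ 2.
Proof. by rewrite /= !mxE. Qed.

Let c0 i : max_second_moment b2 g 0 0 i = 0. Proof. by rewrite mxE. Qed.

Let cS i k : max_second_moment b2 g k.+1 0 i =
  Num.max (max_second_moment b2 g k 0 i) (second_moment b2 g k.+1 0 i).
Proof. by rewrite [max_second_moment _ _ _]/= mxE. Qed.

Let x1 i : a 0 i <= x 1%N 0 i <= b 0 i.
Proof. by case: hpath => /(_ i). Qed.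

(** On a box the objective is a sum of functions [phi j] of single coordinates. Replacing only
    coordinate [i] of the minimizer by [z] stays in the box and leaves the other summands
    unchanged. *)
Lemma apam_coordinate i k : (1 <= k <= K)%N ->
  [/\ a 0 i <= x k.+1 0 i <= b 0 i,
   forall z, a 0 i <= z <= b 0 i ->
    momentum b1 g k 0 i * x k.+1 0 i +
      (2 * s)^-1 * (Num.sqrt (max_second_moment b2 g k 0 i) * (x k.+1 0 i - x k 0 i) ^+ 2) <=
    momentum b1 g k 0 i * z +
      (2 * s)^-1 * (Num.sqrt (max_second_moment b2 g k 0 i) * (z - x k 0 i) ^+ 2) &
   max_second_moment b2 g k 0 i = 0 -> x k.+1 0 i = x k 0 i].
Proof.
move=> hk; have /andP[k1 kK] := hk; case: hpath => _ /(_ k k1) [[xb xmin] xfix].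
split; [exact: xb| |exact: xfix].
move=> z zab.
pose y : 'rV[R]_n := \row_j (if j == i then z else x k.+1 0 j).
have yb : box a b y.
  by move=> j; rewrite mxE; case: eqP => [->//|_]; exact: xb.
pose phi j t := momentum b1 g k 0 j * t +
  (2 * s)^-1 * (Num.sqrt (max_second_moment b2 g k 0 j) * (t - x k 0 j) ^+ 2).
have obj (u : 'rV[R]_n) : dotv (momentum b1 g k) u + (2 * s)^-1 *
    wnorm_sqr (map_mx Num.sqrt (max_second_moment b2 g k)) (u - x k) = \sum_j phi j (u 0 j).
  rewrite /dotv /wnorm_sqr mulr_sumr -big_split; apply: eq_bigr => j _.
  by rewrite !mxE.
have := xmin y yb; rewrite (hstep hk) !obj (bigD1 i)//= [leRHS](bigD1 i)//= mxE eqxx.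
rewrite [X in _ <= _ + X](eq_bigr (fun j => phi j (x k.+1 0 j))) ?lerD2r//.
by move=> j ji; rewrite mxE (negbTE ji).
Qed.

Lemma apam_step_le i k : (1 <= k <= K)%N -> `|x k.+1 0 i - x k 0 i| <= s * q.
Proof.
exact: (iterate_step_le (g := fun k => g k 0 i) b101 b201 (m0 i) (mS i) (v0 i) (vS i) (c0 i) (cS i) s0 (x1 i)
  (@apam_coordinate i)).
Qed.

(** Triangle inequality over [j] steps. The condition [j < k] keeps them at indices at least 1, and
    the last one starts at [k - 1 <= K]. *)
Lemma apam_delay_le i k j : (j < k)%N -> (k <= K.+1)%N ->
  `|x k 0 i - x (k - j)%N 0 i| <= j%:R * (s * q).
Proof.
move=> + kK; elim: j => [|j IH] jk; first by rewrite subn0 subrr normr0 mul0r.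
rewrite -natr1 mulrDl mul1r -(subrKA (x (k - j)%N 0 i)).
rewrite (le_trans (ler_normD _ _))// lerD ?IH 1?ltnW//.
have -> : (k - j = (k - j.+1).+1)%N by rewrite (subnSK (ltnW jk)).
by apply: apam_step_le; rewrite subn_gt0 jk leq_subLR (leq_trans kK)// addSn ltnS leq_addl.
Qed.

(** Different coordinates of [z] may come from different iterates, so the distance is bounded
    coordinate by coordinate, whence the factor [n]. *)
Lemma apam_delayed_distance k z d tau : (1 <= k <= K)%N -> (d <= tau)%N ->
  within_delay x k z d -> norm2 (x k - z) ^+ 2 <= n%:R * (tau%:R * (s * q)) ^+ 2.
Proof.
move=> /andP[k1 kK] dt hz; apply: norm2_sqr_le => i; rewrite !mxE.
have [j [jd jk ->]] := hz i.
apply: le_trans (apam_delay_le i jk (leqW kK)) _.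
rewrite ler_wpM2r ?ler_nat ?(leq_trans jd)//.
by rewrite mulr_ge0 ?(ltW s0)// invr_ge0 sqrtr_ge0.
Qed.

(** The scalar regrets are added over the coordinates: the max-norm bounds [D] and [G] serve each
    coordinate and yield the factor [n], while the absolute gradients add up to the l1-norm. *)
Lemma apam_regret (u : 'rV[R]_n) (D G : R) : (0 < K)%N -> box a b u ->
  (forall y z, box a b y -> box a b z -> `|y - z| <= D) ->
  (forall k, (1 <= k <= K)%N -> `|g k| <= G) ->
  (1 - b1) * \sum_(1 <= k < K.+1) geom_tail b1 K k * dotv (g k) (x k - u) <=
  (2 * s)^-1 * (n%:R * (G * D ^+ 2)) +
  s * q * (1 + b1) / (2 * (1 - b1)) * \sum_(1 <= k < K.+1) norm1 (g k).
Proof.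
move=> K0 ub hD hG.
have G0 : 0 <= G by rewrite (le_trans _ (hG 1%N _)) ?K0.
have -> : \sum_(1 <= k < K.+1) geom_tail b1 K k * dotv (g k) (x k - u) =
    \sum_i \sum_(1 <= k < K.+1) geom_tail b1 K k * (g k 0 i * (x k 0 i - u 0 i)).
  rewrite exchange_big; apply: eq_bigr => k _; rewrite /dotv mulr_sumr.
  by apply: eq_bigr => i _; rewrite !mxE.
have -> : \sum_(1 <= k < K.+1) norm1 (g k) = \sum_i \sum_(1 <= k < K.+1) `|g k 0 i|.
  by rewrite exchange_big.
have -> : (2 * s)^-1 * (n%:R * (G * D ^+ 2)) = \sum_(i < n) (2 * s)^-1 * (G * D ^+ 2).
  by rewrite sumr_const card_ord -[RHS]mulr_natl; ring.
rewrite !mulr_sumr -big_split; apply: ler_sum => i _.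
apply: (scalar_regret (g := fun k => g k 0 i) b101 b201 (m0 i) (mS i) (v0 i) (vS i) (c0 i) (cS i) s0 (x1 i)
  (@apam_coordinate i) (ub i) _ G0).
- move=> k /andP[k1 _]; have := hD _ _ (apam_path_in k1) ub.
  by apply: le_trans; have := coord_le_norm (x k - u) i; rewrite !mxE.
- by move=> k hk; exact: le_trans (coord_le_norm _ _) (hG k hk).
Qed.

End ApamPath.

(** * Stochastic gradients *)

Lemma probability_inhabited {R : realType} {d : measure_display} {T : measurableType d}
  (P : probability T R) : [set: T] !=set0.
Proof.
apply/set0P/negP => /eqP T0; have := probability_setT P.
by rewrite T0 measure0 => /esym/eqP; rewrite onee_eq0.
Qed.

Section FreezingBound.
Context {R : realType} {d d1 d2 : measure_display} {T : measurableType d}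
  {T1 : measurableType d1} {T2 : measurableType d2}.
Variables (P : probability T R) (mu : probability T2 R) (Z1 : T -> T1) (Z2 : T -> T2).
Hypothesis mZ1 : measurable_fun setT Z1.
Hypothesis lawZ2 : has_law P mu Z2.
Hypothesis indZ : independent_systems P (sigma_of Z2) (sigma_of Z1).
Local Open Scope ereal_scope.

(** The bound is asked only at values taken by [Z1], because the assumptions on the subgradients
    hold only on [X]. *)
Lemma independent_integral_le (h : T1 * T2 -> \bar R) (c : \bar R) :
  measurable_fun setT h -> (forall p, 0 <= h p) -> 0 <= c ->
  (forall w, \int[mu]_z h (Z1 w, z) <= c) -> \int[P]_w h (Z1 w, Z2 w) <= c.
Proof.
move=> mh h0 c0 hc; rewrite (independent_integral mZ1 lawZ2 indZ mh h0).
have -> : c = \int[P]_w (cst c w) by rewrite integral_cst//= [P _]probability_setT mule1.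
apply: ge0_le_integral => //.
- by move=> w _; apply: integral_ge0.
- have mF : measurable_fun setT (fubini_F mu h) by exact: measurable_fun_fubini_tonelli_F.
  exact: (measurableT_comp mF mZ1).
Qed.

(** The previous bound with [c = 0], applied to the indicator of the complement of [B], whose
    sections are negligible. *)
Lemma independent_ae (B : set (T1 * T2)) : measurable B ->
  (forall w, mu.-negligible [set z | ~ B (Z1 w, z)]) ->
  {ae P, forall w, B (Z1 w, Z2 w)}.
Proof.
move=> mB hB; have mBc := measurableC mB.
have mZ : measurable_fun setT (fun w => (Z1 w, Z2 w)).
  by apply: measurable_fun_pair => //; case: lawZ2.
pose N := [set w | (~` B) (Z1 w, Z2 w)].
have mN : measurable N by rewrite -[N]setTI; exact: mZ.
exists N; split => //.
apply/eqP; rewrite eq_le measure_ge0 andbT.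
have -> : P N = \int[P]_w (EFin \o \1_(~` B)) (Z1 w, Z2 w).
  have -> : (fun w => (EFin \o \1_(~` B)) (Z1 w, Z2 w)) = EFin \o (\1_N : T -> R).
    by apply/funext => w /=; rewrite !indicE.
  by rewrite integral_indic// setIT.
apply: independent_integral_le => //.
- by apply/measurable_EFinP; exact: measurable_indic.
- by move=> p; rewrite /= lee_fin.
move=> w; have mS := measurable_xsection (Z1 w) mBc.
have -> : (fun z => (EFin \o \1_(~` B)) (Z1 w, z)) = EFin \o (\1_(xsection (~` B) (Z1 w)) : T2 -> R).
  by apply/funext => z /=; rewrite !indicE mem_xsection.
rewrite integral_indic// setIT.
rewrite le_eqVlt; apply/orP; left; apply/eqP.
apply: measure_negligible => //; apply: negligibleS (hB w) => z.
by rewrite /xsection /= inE.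
Qed.

End FreezingBound.

Section Minibatch.
Context {R : realType} {n : nat} {d d' : measure_display}
  {T : measurableType d} {Xi : measurableType d'}.
Variables (P : probability T R) (mu : probability Xi R).
Variables (sg : 'rV[R]_n -> Xi -> 'rV[R]_n) (bsz : nat -> nat)
  (xi : nat -> nat -> T -> Xi) (xhat : nat -> T -> 'rV[R]_n) (k : nat).
Variables (X : set 'rV[R]_n) (G1 Ginf : R).
Hypothesis msg : measurable_fun [set: borel 'rV[R]_n * Xi]
    ((fun p => sg p.1 p.2) : borel 'rV[R]_n * Xi -> borel 'rV[R]_n).
Hypothesis mxhat : random_vector (xhat k).
Hypothesis xhatX : forall w, X (xhat k w).
Hypothesis bsz0 : (0 < bsz k)%N.
Hypothesis xi_law : forall i, (i < bsz k)%N -> has_law P mu (xi k i).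
Hypothesis xi_indep : forall i, (i < bsz k)%N ->
  independent_systems P (sigma_of (xi k i)) (sigma_of (xhat k : T -> borel 'rV[R]_n)).
Hypothesis hG1 : forall y, X y -> ('E_mu[fun z => norm1 (sg y z)] <= G1%:E)%E.
Hypothesis hGinf : forall y, X y -> {ae mu, forall z, `|sg y z| <= Ginf}.

Let g := minibatch_gradient sg bsz xi xhat k.
Let b0 : 0 < (bsz k)%:R^-1 :> R. Proof. by rewrite invr_gt0 ltr0n. Qed.

Let msample i : (i < bsz k)%N ->
  measurable_fun setT (fun w => sg (xhat k w) (xi k i w) : borel 'rV[R]_n).
Proof.
move=> ib; have [mxi _] := xi_law ib.
have mp : measurable_fun setT (fun w => (xhat k w : borel 'rV[R]_n, xi k i w)).
  exact: measurable_fun_pair.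
exact: (measurableT_comp msg mp).
Qed.

Let gE i w : g w 0 i = (bsz k)%:R^-1 * \sum_(j < bsz k) sg (xhat k w) (xi k j w) 0 i.
Proof. by rewrite /g /minibatch_gradient !mxE summxE. Qed.

Lemma minibatch_coord_measurable i : measurable_fun setT (fun w => g w 0 i).
Proof.
have -> : (fun w => g w 0 i) =
    (fun w => (bsz k)%:R^-1 * \sum_(j < bsz k) sg (xhat k w) (xi k j w) 0 i).
  by apply/funext => w; rewrite gE.
apply: measurable_funM => //; apply: measurable_sum => j.
exact: (measurableT_comp (coord_measurable i) (msample (ltn_ord j))).
Qed.

Lemma minibatch_norm1_le w :
  norm1 (g w) <= (bsz k)%:R^-1 * \sum_(j < bsz k) norm1 (sg (xhat k w) (xi k j w)).
Proof.
rewrite /norm1 exchange_big /= mulr_sumr; apply: ler_sum => i _.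
by rewrite gE normrM (ger0_norm (ltW b0)) ler_pM2l// ler_norm_sum.
Qed.

(** Each sample is independent of [xhat k], so the bound at a fixed point of [X] carries over to the
    random point; averaging over the batch preserves it. *)
Lemma minibatch_norm1 : P.-integrable setT (EFin \o (fun w => norm1 (g w))) /\
  Rintegral P setT (fun w => norm1 (g w)) <= G1.
Proof.
pose N j w := norm1 (sg (xhat k w) (xi k j w)).
have mN (j : 'I_(bsz k)) : measurable_fun setT (N j).
  exact: (measurableT_comp norm1_measurable (msample (ltn_ord j))).
have hN (j : 'I_(bsz k)) : (\int[P]_w (N j w)%:E <= G1%:E)%E.
  have mh : measurable_fun setT ((EFin \o (fun p => norm1 (sg p.1 p.2))) : borel 'rV[R]_n * Xi -> \bar R).
    by apply/measurable_EFinP; exact: (measurableT_comp norm1_measurable msg).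
  have jb := ltn_ord j.
  apply: (independent_integral_le mxhat (xi_law jb) (xi_indep jb) mh).
  - by move=> p; rewrite /= lee_fin norm1_ge0.
  (* [G1] is nonnegative because it bounds an expected norm at some point of [X], here a value of
     [xhat k]. *)
  - have [w _] := probability_inhabited P.
    apply: le_trans (hG1 (xhatX w)); rewrite unlock; apply: integral_ge0 => z _.
    by rewrite lee_fin norm1_ge0.
  - by move=> w; have := hG1 (xhatX w); rewrite unlock.
have Ni (j : 'I_(bsz k)) : P.-integrable setT (EFin \o N j).
  apply/integrableP; split; first exact/measurable_EFinP.
  apply: le_lt_trans (ltry G1); apply: le_trans (hN j).
  by under eq_integral do rewrite /= ger0_norm ?norm1_ge0//.
have Si : P.-integrable setT (EFin \o (fun w => (bsz k)%:R^-1 * \sum_(j < bsz k) N j w)).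
  by apply: integrableR_Z; apply: integrableR_sum => j _; exact: Ni.
have gi : P.-integrable setT (EFin \o (fun w => norm1 (g w))).
  apply: (le_integrable measurableT _ _ Si).
    apply/measurable_EFinP; rewrite /norm1; apply: measurable_sum => i.
    by apply: measurableT_comp => //; exact: minibatch_coord_measurable.
  move=> w _; rewrite /= lee_fin (ger0_norm (norm1_ge0 _)).
  exact: le_trans (minibatch_norm1_le w) (ler_norm _).
split=> //; apply: le_trans (le_Rintegral measurableT gi Si _) _.
  by move=> w _; exact: minibatch_norm1_le.
rewrite RintegralZl//; last by apply: integrableR_sum => j _; exact: Ni.
rewrite Rintegral_sum; last by move=> j _; exact: Ni.
rewrite mulrC ler_pdivrMr ?ltr0n//.
apply: (@le_trans _ _ (\sum_(j < bsz k) G1)); last by rewrite sumr_const card_ord mulr_natr.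
apply: ler_sum => j _; rewrite -lee_fin /Rintegral fineK ?hN//.
exact: integrable_fin_num (Ni j).
Qed.

Lemma minibatch_bounded : {ae P, forall w, `|g w| <= Ginf}.
Proof.
pose B : set (borel 'rV[R]_n * Xi) := [set p | `|sg p.1 p.2| <= Ginf].
have mB : measurable B.
  have mh : measurable_fun setT ((fun p => `|sg p.1 p.2|) : borel 'rV[R]_n * Xi -> R).
    exact: (measurableT_comp maxnorm_measurable msg).
  rewrite (_ : B = setT `&` (fun p => `|sg p.1 p.2|) @^-1` `]-oo, Ginf]).
    exact: mh.
  by rewrite setTI; apply/seteqP; split => p /=; rewrite in_itv.
(* Stated for all natural [j], with the range as a premise, to allow a countable intersection. *)
have hB j : {ae P, forall w, (j < bsz k)%N -> `|sg (xhat k w) (xi k j w)| <= Ginf}.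
  have [jb|jb] := ltnP j (bsz k); last by apply: aeW => w.
  have := @independent_ae _ _ _ _ _ _ _ P mu _ _ mxhat (xi_law jb) (xi_indep jb) B mB.
  move=> /(_ (fun w => hGinf (xhatX w))); apply: filterS => w + _; exact.
have := ae_foralln hB; apply: filterS => w hw.
rewrite /g /minibatch_gradient normrZ (ger0_norm (ltW b0)).
rewrite mulrC ler_pdivrMr ?ltr0n// (le_trans (ler_norm_sum _ _ _))//.
apply: (@le_trans _ _ (\sum_(j < bsz k) Ginf)); last by rewrite sumr_const card_ord mulr_natr.
by apply: ler_sum => j _; exact: hw.
Qed.

End Minibatch.

(** * Conditional expectation and the random output index *)

Section SubSigmaAlgebra.
Context {R : realType} {d : measure_display} {T : measurableType d}.
Variables (P : probability T R) (G : set (set T)).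
Hypothesis Gm : G `<=` measurable.
Hypothesis GT : G setT.

Lemma Rintegral_indic (f : T -> R) (A : set T) :
  Rintegral P setT (fun w => f w * \1_A w) = Rintegral P A f.
Proof.
by rewrite [RHS]Rintegral_mkcond; apply: eq_Rintegral => w _; rewrite patch_indic.
Qed.

(** The difference [Z - Y] integrates to zero over every event of [G], hence also against the
    bounded [G]-measurable [W]. *)
Lemma cond_expectation_mul (Z Y W : T -> R) (lo w : R) :
  P.-integrable setT (EFin \o Z) -> is_cond_expectation P G Z Y ->
  measurable_fun setT W -> (forall t, G [set s | t <= W s]) ->
  (forall t, lo <= W t <= lo + w) ->
  Rintegral P setT (fun t => Z t * W t) = Rintegral P setT (fun t => Y t * W t).
Proof.
move=> Zi [_ Yi YZ] mW GW Wb.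
have Wn t : `|W t| <= `|lo| + `|w|.
  have /andP[h1 h2] := Wb t.
  have [l1 l2] := (ler_norm lo, ler_norm w).
  have l3 : - lo <= `|lo| by rewrite -normrN ler_norm.
  have l4 : - w <= `|w| by rewrite -normrN ler_norm.
  by rewrite ler_norml; apply/andP; split; lra.
have i1 := integrableR_mul Zi mW Wn; have i2 := integrableR_mul Yi mW Wn.
apply/eqP; rewrite -subr_eq0 -RintegralB//; apply/eqP.
under eq_Rintegral do rewrite -mulrBl.
apply: (Rintegral_mul_eq0 Gm GT (integrableR_B Zi Yi) _ mW GW Wb) => A GA.
have mA := Gm GA.
rewrite Rintegral_indic RintegralB//; last 2 first.
- by apply: integrableS Zi.
- by apply: integrableS Yi.
by rewrite /Rintegral (YZ A GA) subrr.
Qed.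

(** Decompose along the events [A k] on which [kappa] equals [k]. By independence the centred
    indicator of [A k] integrates to zero over the events of [G], hence against [Z k]. *)
Lemma random_index_integral (K : nat) (kappa : T -> nat) (Z : nat -> T -> R) (M : R) :
  measurable_fun setT kappa -> (forall w, (1 <= kappa w <= K)%N) ->
  independent_systems P (sigma_of kappa) G ->
  (forall k, (1 <= k <= K)%N -> measurable_fun setT (Z k)) ->
  (forall k t, (1 <= k <= K)%N -> G [set w | t <= Z k w]) ->
  (forall k w, (1 <= k <= K)%N -> 0 <= Z k w <= M) ->
  P.-integrable setT (EFin \o (fun w => Z (kappa w) w)) /\
  Rintegral P setT (fun w => Z (kappa w) w) =
  \sum_(1 <= k < K.+1) fine (P (kappa @^-1` [set k])) * Rintegral P setT (Z k).
Proof.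
move=> mk hk ind mZ GZ Zb.
pose A k := kappa @^-1` [set k].
have mA k : measurable (A k) by rewrite -[A k]setTI; exact: mk.
have mem k : k \in index_iota 1 K.+1 -> (1 <= k <= K)%N.
  by rewrite mem_index_iota ltnS.
have Zn k w : (1 <= k <= K)%N -> `|Z k w| <= M.
  by move=> kK; have /andP[h0 h1] := Zb k w kK; rewrite ger0_norm.
have Ai k : P.-integrable setT (EFin \o (\1_(A k) : T -> R)).
  exact: integrable_indic.
have ZE : (fun w => Z (kappa w) w) = (fun w => \sum_(k <- index_iota 1 K.+1) \1_(A k) w * Z k w).
  apply/funext => w; rewrite (bigD1_seq (kappa w)) ?iota_uniq//=; last first.
    by rewrite mem_index_iota ltnS.
  rewrite indicE mem_set//= mul1r big1 ?addr0// => k kw.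
  by rewrite indicE memNset ?mul0r//= /A /= => e; rewrite e eqxx in kw.
have AZi k : k \in index_iota 1 K.+1 -> P.-integrable setT (EFin \o (fun w => \1_(A k) w * Z k w)).
  by move=> /mem kK; apply: (integrableR_mul (Ai k) (mZ k kK)) => w; exact: Zn.
rewrite ZE; split; first exact: integrableR_sum.
rewrite Rintegral_sum//; apply: eq_big_seq => k /[dup] kin /mem kK.
set p := fine _.
have pi : P.-integrable setT (EFin \o (cst p : T -> R)) by exact: finite_measure_integrable_cst.
have Zi := integrable_bounded P (mZ k kK) (fun w => Zn k w kK).
apply/eqP; rewrite -subr_eq0 -RintegralZl// -RintegralB//; last 2 first.
- exact: AZi.
- exact: integrableR_Z.
under eq_Rintegral do rewrite -mulrBl.
apply/eqP/(@Rintegral_mul_eq0 _ _ _ _ G (fun w => \1_(A k) w - p) (Z k) 0 M) => //.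
- exact: integrableR_B.
- move=> B GB; have mB := Gm GB.
  have BP : Rintegral P setT (\1_B : T -> R) = fine (P B).
    by rewrite /Rintegral integral_indic// setIT.
  have Bi : P.-integrable setT (EFin \o (\1_B : T -> R)) by exact: integrable_indic.
  have ABi : P.-integrable setT (EFin \o (\1_(A k `&` B) : T -> R)).
    by apply: integrable_indic => //; exact: measurableI.
  have -> : (fun t => (\1_(A k) t - p) * \1_B t) = (fun t => \1_(A k `&` B) t - p * \1_B t : R).
    by apply/funext => t; rewrite mulrBl indicI.
  rewrite RintegralB//; last exact: integrableR_Z.
  rewrite RintegralZl// BP /Rintegral integral_indic ?setIT//; last exact: measurableI.
  have AB : P (A k `&` B) = (P (A k) * P B)%E.
    by apply: ind => //; exists [set k] => //; rewrite setTI.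
  apply/eqP; rewrite subr_eq0; apply/eqP/(etrans (congr1 fine AB)).
  by rewrite fineM//; exact: fin_num_measure.
- exact: mZ.
- by move=> t; exact: GZ.
- by move=> t; rewrite add0r; exact: Zb.
Qed.

End SubSigmaAlgebra.

(** * From unbiased delayed gradients to the optimality gap *)

Section UnbiasedGap.
Context {R : realType} {d : measure_display} {T : measurableType d} {n : nat}.
Variables (P : probability T R) (G : set (set T)).
Hypothesis Gm : G `<=` measurable.
Hypothesis GT : G setT.

(** As [x - u] is bounded and [G]-measurable, [g] can be replaced by its conditional expectation [Y]
    under the integral; the inequality then holds almost surely. *)
Lemma unbiased_gap (x z g Y : T -> 'rV[R]_n) (F : 'rV[R]_n -> R) (L Q : R)
    (a b u : 'rV[R]_n) :
  L_smooth L F -> random_vector x ->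
  (forall (h : 'rV[R]_n -> R) t, measurable_fun setT (h : borel 'rV[R]_n -> R) ->
    G [set w | t <= h (x w)]) ->
  (forall w, box a b (x w)) ->
  (forall i, P.-integrable setT (EFin \o (fun w => g w 0 i))) ->
  (forall i, is_cond_expectation P G (fun w => g w 0 i) (fun w => Y w 0 i)) ->
  {ae P, forall w, subdifferential F (z w) (Y w)} ->
  (forall w, L / 2 * norm2 (x w - z w) ^+ 2 <= Q) ->
  P.-integrable setT (EFin \o (fun w => F (x w) - F u)) ->
  P.-integrable setT (EFin \o (fun w => dotv (g w) (x w - u))) /\
  Rintegral P setT (fun w => F (x w) - F u) <=
  Rintegral P setT (fun w => dotv (g w) (x w - u)) + Q.
Proof.
move=> LF mx Gx xb gi gY YF hQ Fi.
have mxi i : measurable_fun setT (fun w => x w 0 i - u 0 i).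
  apply: measurable_funB => //; exact: (measurableT_comp (coord_measurable i) mx).
have xib i w : a 0 i - u 0 i <= x w 0 i - u 0 i <= a 0 i - u 0 i + (b 0 i - a 0 i).
  by have /andP[h1 h2] := xb w i; apply/andP; split; lra.
have xin i w : `|x w 0 i - u 0 i| <= `|a 0 i - u 0 i| + `|b 0 i - u 0 i|.
  have /andP[h1 h2] := xib i w.
  have l1 := ler_norm (b 0 i - u 0 i).
  have l2 : - (a 0 i - u 0 i) <= `|a 0 i - u 0 i| by rewrite -normrN ler_norm.
  have l3 := normr_ge0 (a 0 i - u 0 i); have l4 := normr_ge0 (b 0 i - u 0 i).
  by rewrite ler_norml; apply/andP; split; lra.
have Yi i : P.-integrable setT (EFin \o (fun w => Y w 0 i)) by case: (gY i).
have dE (h : T -> 'rV[R]_n) : (fun w => dotv (h w) (x w - u)) =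
    (fun w => \sum_(i <- index_enum 'I_n) h w 0 i * (x w 0 i - u 0 i)).
  by apply/funext => w; apply: eq_bigr => i _; rewrite !mxE.
have dgi i : P.-integrable setT (EFin \o (fun w => g w 0 i * (x w 0 i - u 0 i))).
  exact: integrableR_mul (gi i) (mxi i) (xin i).
have dYi i : P.-integrable setT (EFin \o (fun w => Y w 0 i * (x w 0 i - u 0 i))).
  exact: integrableR_mul (Yi i) (mxi i) (xin i).
have dg : P.-integrable setT (EFin \o (fun w => dotv (g w) (x w - u))).
  by rewrite dE; apply: integrableR_sum.
have dY : P.-integrable setT (EFin \o (fun w => dotv (Y w) (x w - u))).
  by rewrite dE; apply: integrableR_sum.
have Qi : P.-integrable setT (EFin \o (cst Q : T -> R)) by exact: finite_measure_integrable_cst.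
split=> //.
have -> : Rintegral P setT (fun w => dotv (g w) (x w - u)) =
    Rintegral P setT (fun w => dotv (Y w) (x w - u)).
  rewrite !dE !Rintegral_sum//; apply: eq_bigr => i _.
  apply: (cond_expectation_mul Gm GT (gi i) (gY i) (mxi i) _ (xib i)) => t.
  have := Gx (fun v => v 0 i) (t + u 0 i) (coord_measurable i).
  by congr G; apply/funext => w /=; rewrite lerBrDr.
have -> : Q = Rintegral P setT (cst Q).
  rewrite Rintegral_cst// [X in _ * X](_ : _ = 1) ?mulr1//.
  exact: (congr1 fine (probability_setT P)).
rewrite -RintegralD//; apply: ae_le_Rintegral => //; first exact: integrableR_D.
apply: filterS YF => w YF; have [dF _] := LF.
have YE := subdifferential_gradient dF YF.
(* [Y] serves twice: as subgradient at [z] it bounds [F u] from below, and as gradient at [z] it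
   bounds [F x] from above by the descent lemma. *)
have := YF u; have := descent_lemma (z w) (x w) LF; rewrite -YE => h1 h2.
have -> : dotv (Y w) (x w - u) = dotv (Y w) (x w - z w) - dotv (Y w) (u - z w).
  by rewrite -dotvBr; congr dotv; rewrite opprB addrA subrK.
by have := hQ w; rewrite /=; lra.
Qed.

End UnbiasedGap.

(** * The convergence bound *)

(** In dimension 0 the sign of [L] is undetermined, but then both sides are 0. *)
Lemma L_smooth_mul {R : realType} {n : nat} (L N M : R) (F : 'rV[R]_n -> R) :
  L_smooth L F -> 0 <= N <= n%:R * M -> L * N <= L * (n%:R * M).
Proof.
move=> LF /andP[N0 NM]; have [n0|npos] := posnP n.
  move: NM; rewrite n0 mul0r => NM.
  by have -> : N = 0 by apply/eqP; rewrite eq_le NM N0.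
have x0 : (const_mx 1 : 'rV[R]_n) != 0.
  by apply/eqP => /rowP/(_ (Ordinal npos)); rewrite !mxE => /eqP; rewrite oner_eq0.
by rewrite ler_wpM2l// (L_smooth_ge0 LF x0).
Qed.

Lemma output_weightE {R : realType} (b1 : R) (step : nat -> R) (K k : nat) (s : R) :
  s != 0 -> (forall j, (1 <= j <= K)%N -> step j = s) -> (1 <= k <= K)%N ->
  output_weight b1 step K k =
  geom_tail b1 K k / \sum_(1 <= t < K.+1) geom_tail b1 K t.
Proof.
move=> s0 hs kK.
have num t : (1 <= t)%N ->
    \sum_(t <= j < K.+1) step j * b1 ^+ (j - t) = s * geom_tail b1 K t.
  move=> t1; rewrite /geom_tail mulr_sumr; apply: eq_big_nat => j /andP[tj jK].
  by rewrite hs// (leq_trans t1).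
rewrite /output_weight num; last by case/andP: kK.
have -> : \sum_(1 <= t < K.+1) \sum_(t <= j < K.+1) step j * b1 ^+ (j - t) =
    s * \sum_(1 <= t < K.+1) geom_tail b1 K t.
  by rewrite mulr_sumr; apply: eq_big_nat => t /andP[t1 _]; exact: num.
by rewrite -mulf_div divff// mul1r.
Qed.

(** The final arithmetic, with [e k] the expected gap, [d k] the expected linearized regret,
    [N = n Dinf^2 Ginf], [C1 = G1] and [C2 = L tau^2 n]. The three summands are compared one by one:
    the first is exact, the others lose factors [1 - b1^2] and [1 - b1]. *)
Lemma weighted_regret_bound {R : realType} (K : nat) (b1 b2 alpha N C1 C2 : R)
    (w e d : nat -> R) : (0 < K)%N -> 0 < alpha -> 0 <= b1 < 1 -> 0 <= b2 < 1 ->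
  0 <= N -> 0 <= C1 -> 0 <= C2 ->
  (forall k, (1 <= k <= K)%N -> 1 <= w k) ->
  let s := alpha / Num.sqrt K%:R in
  let q := (Num.sqrt (1 - b2))^-1 in
  (forall k, (1 <= k <= K)%N -> e k <= d k + (s * q) ^+ 2 / 2 * C2) ->
  (1 - b1) * \sum_(1 <= k < K.+1) w k * d k <=
    (2 * s)^-1 * N + s * q * (1 + b1) / (2 * (1 - b1)) * (K%:R * C1) ->
  \sum_(1 <= k < K.+1) w k / (\sum_(1 <= t < K.+1) w t) * e k <=
  (2 * alpha * Num.sqrt K%:R * (1 - b1))^-1 *
      (N + alpha ^+ 2 * C1 / ((1 - b1) ^+ 2 * Num.sqrt (1 - b2))
       + alpha ^+ 3 * C2 / (Num.sqrt K%:R * (1 - b2))).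
Proof.
move=> K0 a0 /andP[b10 b11] /andP[b20 b21] N0 C10 C20 w1 s q he hd.
set W := \sum_(1 <= t < K.+1) w t.
set Q := (s * q) ^+ 2 / 2 * C2 in he.
have S0 : 0 < Num.sqrt K%:R :> R by rewrite sqrtr_gt0 ltr0n.
have s0 : 0 < s by rewrite divr_gt0.
have b2' : 0 < Num.sqrt (1 - b2) by rewrite sqrtr_gt0 subr_gt0.
have q0 : 0 < q by rewrite invr_gt0.
have Q0 : 0 <= Q by rewrite /Q mulr_ge0// divr_ge0// sqr_ge0.
have KR : 0 < K%:R :> R by rewrite ltr0n.
have KW : K%:R <= W.
  have -> : K%:R = \sum_(1 <= t < K.+1) (1 : R).
    by rewrite big_const_nat subn1 /= iter_addr_0.
  by apply: ler_sum_nat => k hk; exact: w1.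
have W0 : 0 < W := lt_le_trans KR KW.
have b1' : 0 < 1 - b1 by rewrite subr_gt0.
set B := (2 * s)^-1 * N + _ in hd.
have B0 : 0 <= B.
  have h1 : 0 <= (2 * s)^-1 by rewrite invr_ge0 mulr_ge0 ?(ltW s0).
  have h2 : 0 <= s * q * (1 + b1) / (2 * (1 - b1)).
    exact: (divr_ge0 (mulr_ge0 (mulr_ge0 (ltW s0) (ltW q0)) (addr_ge0 ler01 b10))
      (mulr_ge0 (ler0n _ 2) (ltW b1'))).
  exact: (addr_ge0 (mulr_ge0 h1 N0) (mulr_ge0 h2 (mulr_ge0 (ltW KR) C10))).
have avg : \sum_(1 <= k < K.+1) w k / W * e k <= B / ((1 - b1) * K%:R) + Q.
  apply: (@le_trans _ _ (\sum_(1 <= k < K.+1) (w k / W * d k + w k / W * Q))).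
    apply: ler_sum_nat => k hk; rewrite -mulrDr ler_wpM2l ?he//.
    by rewrite divr_ge0 ?(ltW W0)// (le_trans ler01) ?w1.
  rewrite big_split /= -mulr_suml -mulr_suml divff ?gt_eqF// mul1r lerD2r.
  have -> : \sum_(1 <= k < K.+1) w k / W * d k = (\sum_(1 <= k < K.+1) w k * d k) / W.
    by rewrite mulr_suml; apply: eq_bigr => k _; rewrite mulrAC.
  (* Replacing the total weight [W] by the smaller [K] enlarges the quotient because [B] is
     nonnegative. *)
  apply: (@le_trans _ _ (B / ((1 - b1) * W))).
    rewrite ler_pdivlMr ?mulr_gt0// mulrA mulrAC divfK ?gt_eqF// mulrC//.
  by rewrite ler_wpM2l// lef_pV2 ?posrE ?mulr_gt0// ler_pM2l.
apply: le_trans avg _.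
have SE : Num.sqrt K%:R ^+ 2 = K%:R :> R by rewrite sqr_sqrtr// ler0n.
have qE : q ^+ 2 = (1 - b2)^-1 by rewrite exprVn sqr_sqrtr// subr_ge0 ltW.
have part1 : (2 * s)^-1 * N / ((1 - b1) * K%:R) =
   (2 * alpha * Num.sqrt K%:R * (1 - b1))^-1 * N.
  by rewrite /s; move: S0 SE; move: (Num.sqrt K%:R) => S S0 <-; field; rewrite !gt_eqF.
(* [(1 + b1) / (1 - b1) <= 1 / (1 - b1) ^+ 2], the quotient being [1 - b1 ^+ 2]. *)
have part2 : s * q * (1 + b1) / (2 * (1 - b1)) * (K%:R * C1) / ((1 - b1) * K%:R) <=
   (2 * alpha * Num.sqrt K%:R * (1 - b1))^-1 *
    (alpha ^+ 2 * C1 / ((1 - b1) ^+ 2 * Num.sqrt (1 - b2))).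
  have -> : s * q * (1 + b1) / (2 * (1 - b1)) * (K%:R * C1) / ((1 - b1) * K%:R) =
    (1 - b1 ^+ 2) * ((2 * alpha * Num.sqrt K%:R * (1 - b1))^-1 *
    (alpha ^+ 2 * C1 / ((1 - b1) ^+ 2 * Num.sqrt (1 - b2)))).
    by rewrite /s /q; move: S0 SE; move: (Num.sqrt K%:R) => S S0 <-; field; rewrite !gt_eqF.
  apply: ler_piMl; last by rewrite gerBl sqr_ge0.
  apply: mulr_ge0.
    by rewrite invr_ge0 !mulr_ge0 ?(ltW a0) ?(ltW S0) ?(ltW b1').
  apply: divr_ge0; first by rewrite mulr_ge0// sqr_ge0.
  by rewrite mulr_ge0 ?sqr_ge0 ?(ltW b2').
have part3 : Q <= (2 * alpha * Num.sqrt K%:R * (1 - b1))^-1 *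
    (alpha ^+ 3 * C2 / (Num.sqrt K%:R * (1 - b2))).
  have b2n : 0 < 1 - b2 by rewrite subr_gt0.
  have -> : (2 * alpha * Num.sqrt K%:R * (1 - b1))^-1 *
    (alpha ^+ 3 * C2 / (Num.sqrt K%:R * (1 - b2))) = Q / (1 - b1).
    by rewrite /Q exprMn qE /s; move: S0 SE; move: (Num.sqrt K%:R) => S S0 _; field; rewrite !gt_eqF.
  by rewrite ler_pdivlMr// ler_piMr// gerBl.
rewrite /B mulrDl part1; apply: le_trans (lerD (lerD (lexx _) part2) part3) _.
by rewrite -!mulrDr.
Qed.

Theorem theorem3 (R : realType) (n : nat)
  (* the law mu of xi, the loss f(x; xi) and its chosen subgradients *)
  (dXi : measure_display) (Xi : measurableType dXi) (mu : probability Xi R)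
  (f : 'rV[R]_n -> Xi -> R) (sg : 'rV[R]_n -> Xi -> 'rV[R]_n)
  (a b : 'rV[R]_n) (X : set 'rV[R]_n) (hX : X = box a b)
  (hsg : forall x xi, X x -> subgradient (fun y => f y xi) x (sg x xi))
  (hsg_meas : measurable_fun [set: borel 'rV[R]_n * Xi]
    ((fun p => sg p.1 p.2) : borel 'rV[R]_n * Xi -> borel 'rV[R]_n))
  (* the objective *)
  (hf_int : forall x, mu.-integrable setT (EFin \o f x))
  (F : 'rV[R]_n -> R) (hF : F = expected_loss mu f)
  (hF_convex : convex_function setT (F : convex_lmodType 'rV[R]_n -> R^o))
  (Fstar : R) (hFstar : is_min (F @` X) Fstar)
  (Dinf : R) (hDinf : is_max [set `|x - y| | x in X & y in X] Dinf)
  (* the algorithm *)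
  (beta1 beta2 : R) (hbeta1 : 0 <= beta1 < 1) (hbeta2 : 0 <= beta2 < 1)
  (step : nat -> R)
  (dO : measure_display) (Omega : measurableType dO) (P : probability Omega R)
  (x xhat : nat -> Omega -> 'rV[R]_n)
  (hx_meas : forall k, (1 <= k)%N -> random_vector (x k))
  (hxhat_meas : forall k, (1 <= k)%N -> random_vector (xhat k))
  (bsz : nat -> nat) (hbsz : forall k, (1 <= k)%N -> (0 < bsz k)%N)
  (xi : nat -> nat -> Omega -> Xi)
  (hxi_law : forall k i, (1 <= k)%N -> (i < bsz k)%N -> has_law P mu (xi k i))
  (hxi_indep : forall k i, (1 <= k)%N -> (i < bsz k)%N ->
    independent_systems P (sigma_of (xi k i)) (sigma_of (xhat k : Omega -> borel 'rV[R]_n)))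
  (g : nat -> Omega -> 'rV[R]_n) (hg : g = minibatch_gradient sg bsz xi xhat)
  (hrun : forall w, apam_path X beta1 beta2 step (fun k => g k w) (fun k => x k w))
  (delay : nat -> Omega -> nat)
  (hdelay : forall k w, (1 <= k)%N -> is_delay (fun t => x t w) k (xhat k w) (delay k w))
  (* assumptions (i)-(v) *)
  (G1 : R) (hG1 : forall y, X y -> ('E_mu[fun z => norm1 (sg y z)] <= G1%:E)%E)
  (Ginf : R) (hGinf : forall y, X y -> {ae mu, forall z, `|sg y z| <= Ginf})
  (hunbiased : forall k, (1 <= k)%N -> exists Y : Omega -> 'rV[R]_n,
    (forall i, is_cond_expectation P (history x k) (fun w => g k w 0 i) (fun w => Y w 0 i)) /\
    {ae P, forall w, subdifferential F (xhat k w) (Y w)})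
  (L : R) (hL : L_smooth L F)
  (tau : nat) (htau : forall k w, (1 <= k)%N -> (delay k w <= tau)%N)
  (* step sizes *)
  (K : nat) (hK : (0 < K)%N) (alpha : R) (halpha : 0 < alpha)
  (hstep : forall k, (1 <= k <= K)%N -> step k = alpha / Num.sqrt K%:R)
  (* the output is x kappa for a random index kappa drawn independently of the iterates *)
  (kappa : Omega -> nat) (hkappa_meas : measurable_fun setT kappa)
  (hkappa_range : forall w, (1 <= kappa w <= K)%N)
  (hkappa_indep : independent_systems P (sigma_of kappa) (history x K))
  (hkappa_law : forall k, (1 <= k <= K)%N ->
    P (kappa @^-1` [set k]) = (output_weight beta1 step K k)%:E)
  (xbar : Omega -> 'rV[R]_n) (hxbar : xbar = fun w => x (kappa w) w) :
  ('E_P[fun w => (F (xbar w) - Fstar)%R] <=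
    ((2 * alpha * Num.sqrt K%:R * (1 - beta1))^-1 *
      (n%:R * Dinf ^+ 2 * Ginf
       + alpha ^+ 2 * G1 / ((1 - beta1) ^+ 2 * Num.sqrt (1 - beta2))
       + alpha ^+ 3 * L * tau%:R ^+ 2 * n%:R / (Num.sqrt K%:R * (1 - beta2))))%:E)%E.
Proof.
have [[u Xu Fu] Flb] := hFstar.
have Fmin y : X y -> Fstar <= F y by move=> Xy; apply: Flb; exists y.
have hD y z : X y -> X z -> `|y - z| <= Dinf.
  by move=> Xy Xz; apply: hDinf.2; exists y => //; exists z.
subst X Fstar.
have S0 : 0 < Num.sqrt K%:R :> R by rewrite sqrtr_gt0 ltr0n.
set s := alpha / Num.sqrt K%:R in hstep.
have s0 : 0 < s by rewrite divr_gt0.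
pose q : R := (Num.sqrt (1 - beta2))^-1.
have xX k w : (1 <= k)%N -> box a b (x k w) by move=> k1; exact: (apam_path_in (hrun w) k1).
(* A coordinatewise mixture of points of a box lies in the box. *)
have xhatX k w : (1 <= k)%N -> box a b (xhat k w).
  move=> k1 i; have [hw _] := hdelay k w k1.
  by have [j [_ jk ->]] := hw i; apply: xX; rewrite subn_gt0.
have [dF _] := hL.
have mF : measurable_fun setT (F : borel 'rV[R]_n -> R).
  by apply: continuous_borel_measurable => y; exact: differentiable_continuous (dF y).
have mFu : measurable_fun setT ((fun y => F y - F u) : borel 'rV[R]_n -> R).
  exact: measurable_funB.
have Gm j : history x j `<=` measurable by exact: history_measurable.
(* A uniform bound on the gap over the box, from the descent lemma at [u] and the squared Euclidean
   diameter, at most [n Dinf^2]. It makes the gaps integrable. *)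
pose M := norm2 (gradient F u) * Num.sqrt (n%:R * Dinf ^+ 2) + L / 2 * (n%:R * Dinf ^+ 2).
have FM y : box a b y -> 0 <= F y - F u <= M.
  move=> yb; rewrite subr_ge0 Fmin//=.
  have yu : norm2 (y - u) ^+ 2 <= n%:R * Dinf ^+ 2.
    by apply: norm2_sqr_le => i; exact: le_trans (coord_le_norm _ _) (hD _ _ yb Xu).
  have h1 := descent_lemma u y hL.
  have h2 := dotv_le (gradient F u) (y - u).
  have h3 : L * norm2 (y - u) ^+ 2 <= L * (n%:R * Dinf ^+ 2).
    by apply: (L_smooth_mul hL); rewrite sqr_ge0.
  have h4 : norm2 (gradient F u) * norm2 (y - u) <=
      norm2 (gradient F u) * Num.sqrt (n%:R * Dinf ^+ 2).
    rewrite ler_wpM2l ?norm2_ge0// -[leLHS]ger0_norm ?norm2_ge0// -sqrtr_sqr.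
    by rewrite ler_wsqrtr.
  rewrite /M; lra.
have mFx k : (1 <= k)%N -> measurable_fun setT (fun w => F (x k w) - F u).
  by move=> k1; exact: (measurableT_comp mFu (hx_meas k k1)).
have Fi k : (1 <= k)%N -> P.-integrable setT (EFin \o (fun w => F (x k w) - F u)).
  move=> k1; apply: (@integrable_bounded _ _ _ _ _ M); first exact: mFx.
  by move=> w; have /andP[h0 h1] := FM _ (xX k w k1); rewrite ger0_norm.
pose e k := Rintegral P setT (fun w => F (x k w) - F u).
pose gdx k := Rintegral P setT (fun w => dotv (g k w) (x k w - u)).
have gn k : (1 <= k)%N -> P.-integrable setT (EFin \o (fun w => norm1 (g k w))) /\
    Rintegral P setT (fun w => norm1 (g k w)) <= G1.
  move=> k1; rewrite hg.
  exact: (minibatch_norm1 hsg_meas (hxhat_meas k k1) (fun w => xhatX k w k1)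
    (hbsz k k1) (fun i => hxi_law k i k1) (fun i => hxi_indep k i k1) hG1).
have gb k : (1 <= k)%N -> {ae P, forall w, `|g k w| <= Ginf}.
  move=> k1; rewrite hg.
  exact: (minibatch_bounded hsg_meas (hxhat_meas k k1) (fun w => xhatX k w k1)
    (hbsz k k1) (fun i => hxi_law k i k1) (fun i => hxi_indep k i k1) hGinf).
have gi k i : (1 <= k)%N -> P.-integrable setT (EFin \o (fun w => g k w 0 i)).
  move=> k1; have [ni _] := gn k k1.
  apply: (le_integrable measurableT _ _ ni).
    apply/measurable_EFinP; rewrite hg.
    exact: (minibatch_coord_measurable hsg_meas (hxhat_meas k k1) (fun i => hxi_law k i k1)).
  move=> w _ /=; rewrite lee_fin (ger0_norm (norm1_ge0 _)) /norm1 (bigD1 i)//=.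
  by rewrite lerDl sumr_ge0.
have gap k : (1 <= k <= K)%N ->
    P.-integrable setT (EFin \o (fun w => dotv (g k w) (x k w - u))) /\
    e k <= gdx k + (s * q) ^+ 2 / 2 * (L * tau%:R ^+ 2 * n%:R).
  move=> kK; have /andP[k1 _] := kK; have [Y [gY YF]] := hunbiased k k1.
  apply: (@unbiased_gap _ _ _ _ P _ (Gm k) (historyT (x:=x) (K:=k)) (x k) (xhat k) (g k) Y F L _ a b u
    hL (hx_meas k k1) _ _ _ gY YF _ (Fi k k1)).
  - by move=> h t mh; apply: history_ge => //; rewrite k1 leqnn.
  - by move=> w; exact: xX.
  - by move=> i; exact: gi.
  - move=> w; have [hw _] := hdelay k w k1.
    have hd := apam_delayed_distance hbeta1 hbeta2 (hrun w) s0 hstep kK (htau k w k1) hw.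
    have := L_smooth_mul hL (N := norm2 (x k w - xhat k w) ^+ 2) _; rewrite sqr_ge0.
    move=> /(_ _ hd) h; rewrite mulrAC (le_trans (ler_wpM2r _ h))//.
    by rewrite le_eqVlt; apply/orP; left; apply/eqP; rewrite -/q; field.
pose w := geom_tail beta1 K.
pose C := s * q * (1 + beta1) / (2 * (1 - beta1)).
have C0 : 0 <= C.
  case/andP: hbeta1 => b10 b11.
  have q0 : 0 <= q by rewrite invr_ge0 sqrtr_ge0.
  have b1' : 0 <= 1 - beta1 by rewrite subr_ge0 ltW.
  exact: (divr_ge0 (mulr_ge0 (mulr_ge0 (ltW s0) q0) (addr_ge0 ler01 b10))
    (mulr_ge0 (ler0n _ 2) b1')).
have mem k : k \in index_iota 1 K.+1 -> (1 <= k <= K)%N by rewrite mem_index_iota ltnS.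
have regret : (1 - beta1) * \sum_(1 <= k < K.+1) w k * gdx k <=
    (2 * s)^-1 * (n%:R * (Ginf * Dinf ^+ 2)) + C * (K%:R * G1).
  have di k : k \in index_iota 1 K.+1 -> P.-integrable setT
      (EFin \o (fun t => w k * dotv (g k t) (x k t - u))).
    by move=> /mem kK; apply: integrableR_Z; case: (gap k kK).
  have ni k : k \in index_iota 1 K.+1 -> P.-integrable setT
      (EFin \o (fun t => norm1 (g k t))).
    by move=> /mem /andP[k1 _]; case: (gn k k1).
  have lhs : (1 - beta1) * \sum_(1 <= k < K.+1) w k * gdx k = Rintegral P setT
      (fun t => (1 - beta1) * \sum_(k <- index_iota 1 K.+1) w k * dotv (g k t) (x k t - u)).
    rewrite RintegralZl//; last exact: integrableR_sum.
    rewrite Rintegral_sum//; congr (_ * _); apply: eq_big_seq => k /mem kK.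
    by rewrite RintegralZl//; case: (gap k kK).
  set c := (2 * s)^-1 * _.
  have ci : P.-integrable setT (EFin \o (cst c : Omega -> R)).
    exact: finite_measure_integrable_cst.
  have si : P.-integrable setT (EFin \o (fun t => C * \sum_(k <- index_iota 1 K.+1) norm1 (g k t))).
    by apply: integrableR_Z; exact: integrableR_sum.
  have rhs : Rintegral P setT (fun t => c + C * \sum_(k <- index_iota 1 K.+1) norm1 (g k t))
      <= c + C * (K%:R * G1).
    rewrite (RintegralD measurableT ci si) Rintegral_cst//.
    rewrite [X in _ * X](_ : _ = 1); last exact: (congr1 fine (probability_setT P)).
    rewrite mulr1 lerD2l RintegralZl//; last exact: integrableR_sum.
    rewrite Rintegral_sum// ler_wpM2l//.
    have -> : K%:R * G1 = \sum_(1 <= t < K.+1) G1.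
      by rewrite big_const_nat subn1 /= iter_addr_0 mulr_natl.
    by apply: ler_sum_nat => k /andP[k1 _]; case: (gn k k1).
  apply: le_trans rhs; rewrite lhs; apply: ae_le_Rintegral.
  - by apply: integrableR_Z; exact: integrableR_sum.
  - exact: integrableR_D ci si.
  (* The gradients are bounded only almost surely, so one null set is discarded for all [k] at once
     and the pathwise regret is integrated over the rest. *)
  have gball : {ae P, forall t, forall k, (1 <= k)%N -> `|g k t| <= Ginf}.
    apply: ae_foralln => k; have [k0|k1] := leqP k 0; last first.
      by apply: filterS (gb k k1) => t + _.
    exact: aeW.
  apply: filterS gball => t gt.
  by apply: (apam_regret hbeta1 hbeta2 (hrun t) s0 hstep hK Xu hD) => k /andP[k1 _]; exact: gt.
have [t0 _] := probability_inhabited P.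
(* Almost surely [0 <= |g 1| <= Ginf]; integrating the constants gives the sign. *)
have Ginf0 : 0 <= Ginf.
  have c0 (c : R) : Rintegral P setT (cst c : Omega -> R) = c.
    rewrite Rintegral_cst// [X in _ * X](_ : _ = 1) ?mulr1//.
    exact: (congr1 fine (probability_setT P)).
  rewrite -(c0 Ginf) -[leLHS]c0; apply: ae_le_Rintegral.
  - exact: finite_measure_integrable_cst.
  - exact: finite_measure_integrable_cst.
  - by apply: filterS (gb 1%N isT) => t; exact: le_trans.
have G10 : 0 <= G1.
  by apply: le_trans (gn 1%N isT).2; apply: Rintegral_ge0 => t _; exact: norm1_ge0.
(* The expected gap at the output becomes the average of the [e k] under the law of [kappa]. *)
have [Zi ZE] := random_index_integral (Gm K) (historyT (x:=x) (K:=K)) (Z := fun k w => F (x k w) - F u) (M := M)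
  hkappa_meas hkappa_range hkappa_indep
  (fun k kK => mFx k (proj1 (andP kK)))
  (fun k t kK => history_ge t kK mFu)
  (fun k w kK => FM _ (xX k w (proj1 (andP kK)))).
rewrite unlock hxbar -[leLHS]fineK; last exact: integrable_fin_num Zi.
rewrite lee_fin [leLHS]ZE.
rewrite (eq_big_nat _ _ (F2 := fun k => w k / (\sum_(1 <= t < K.+1) w t) * e k)); last first.
  move=> k kK; rewrite hkappa_law//= (output_weightE _ _ hstep kK)//.
  by rewrite gt_eqF.
have C20 : 0 <= L * tau%:R ^+ 2 * n%:R.
  rewrite -mulrA [_ * n%:R]mulrC -[leLHS](mulr0 L); apply: (L_smooth_mul hL).
  by rewrite lexx mulr_ge0// sqr_ge0.
have N0 : 0 <= n%:R * (Ginf * Dinf ^+ 2).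
  by rewrite mulr_ge0// mulr_ge0// sqr_ge0.
have w1 k : (1 <= k <= K)%N -> 1 <= w k.
  by case/andP: hbeta1 => b10 _ /andP[_ kK]; exact: geom_tail_ge1.
have := weighted_regret_bound hK halpha hbeta1 hbeta2 N0 G10 C20 w1
  (fun k kK => (gap k kK).2) regret.
by rewrite [Ginf * _]mulrC !mulrA.
Qed.
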